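(* Let $b>1$ be an integer and $\mathcal D\subset\mathbb Z_{\ge0}$ with $\#\mathcal D=b$. The following are equivalent: (i) $\mathcal D$ is a tile digit set of $b$; (ii) there is a symmetric $P_{\mathcal D}$-blocking in the Protasov tree of $b$; (iii) there is a blocking $\mathcal N$ in the $\Phi$-tree of $b$ such that the kernel polynomial $K(x)=\prod_{\Phi_d\in\mathcal N}\Phi_d(x)$ divides $P_{\mathcal D}(x)$; (iv) $\mathcal D$ satisfies condition $(P_k)$ for some $k\ge1$.
   Context: $P_{\mathcal D}(x)=\sum_{d\in\mathcal D}x^d$; $\Phi_n$ is the $n$-th cyclotomic polynomial. $\mathcal D$ is a tile digit set of $b$ if $\#\mathcal D=b$ and $T(b,\mathcal D)=\{\sum_{k\ge1}b^{-k}d_k:d_k\in\mathcal D\}$ has nonempty interior. Protasov tree: root $\vartheta$, levels $V_k=\{j_k\cdots j_1:j_\ell\in\{0,\dots,b-1\},j_1\neq0\}$ ($k\ge1$), children of $\vartheta$ = $V_1$, children of $\mathbf j\in V_k$ are $\ell\mathbf j$, $0\le\ell\le b-1$; $m_{\mathbf j}=\sum_i j_ib^{i-1}$, $e(m_{\mathbf j})=e^{2\pi im_{\mathbf j}/b^k}$, $\tau(\mathbf j)=\Phi_{b^k/\gcd(m_{\mathbf j},b^k)}$. $\Phi$-tree: root whose children are $\Phi_d$, $d\mid b$, $d>1$; children of $\Phi_d$ are the cyclotomic factors $\Phi_e$ of $\Phi_d(x^b)$. A blocking (in either tree) is a finite set of non-root vertices meeting every infinite path from the root exactly once; a blocking $B$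 of the Protasov tree is symmetric if $\tau^{-1}(\tau(\mathbf j))\subset B$ for $\mathbf j\in B$, and is a $P_{\mathcal D}$-blocking if $P_{\mathcal D}(e(m_{\mathbf j}))=0$ for all $\mathbf j\in B$. Condition $(P_k)$: for a positive integer $t$ let $j(t)=\min\{j\ge0:$ some cyclotomic factor of $\Phi_t(x^{b^j})$ divides $P_{\mathcal D}(x)\}$ ($\infty$ if none); $R_1(t)$ means $\Phi_t(x^{b^j})\mid P_{\mathcal D}(x)$ for some $j\ge0$; for $k\ge2$, $R_k(t)$ means $j(t)<\infty$ and $R_{k-1}(s)$ holds for every cyclotomic factor $\Phi_s$ of $\Phi_t(x^{b^{j(t)}})$; $(P_k)$ means $R_k(d)$ for all divisors $d>1$ of $b$. *)

(* Defs.v *)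
From mathcomp Require Import all_boot all_order all_algebra finmap.
From mathcomp Require Import cyclotomic complex.
From mathcomp Require Import all_classical all_reals all_analysis.

Set Implicit Arguments.
Unset Strict Implicit.
Unset Printing Implicit Defensive.

Import Order.TTheory GRing.Theory Num.Theory numFieldNormedType.Exports.

Local Open Scope classical_set_scope.
Local Open Scope ring_scope.

Definition digit_poly (A : nzRingType) (D : {fset nat}) : {poly A} :=
  \sum_(d <- D) 'X^d.

Definition self_affine_set (R : realType) (b : nat) (D : {fset nat}) : set R :=
  [set x | exists2 d : nat -> nat, (forall k, (1 <= k)%N -> d k \in D) &
     (\sum_(1 <= k < n.+1) (d k)%:R / b%:R ^+ k) @[n --> \oo] --> x].

Definition tile_digit_set (R : realType) (b : nat) (D : {fset nat}) : Prop :=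
  #|` D|%fset = b /\ interior (@self_affine_set R b D) !=set0.

(* In both trees the root is left implicit: [top v] says that v is a child of
   the root, [child v w] that w is a child of the non-root vertex v. The path
   root, v_1, v_2, ... is encoded by [p n] = v_{n+1}. *)
Definition infinite_path (V : Type) (top : V -> Prop) (child : V -> V -> Prop)
    (p : nat -> V) : Prop :=
  top (p 0%N) /\ forall n, child (p n) (p n.+1).

Definition blocking (V : choiceType) (vertex : V -> Prop) (top : V -> Prop)
    (child : V -> V -> Prop) (B : {fset V}) : Prop :=
  (forall v, v \in B -> vertex v) /\
  (forall p, infinite_path top child p -> exists! n, p n \in B).

(* The word j_k ... j_1 is the list [:: j_k; ...; j_1]. *)
Definition protasov_level (b k : nat) (j : seq nat) : Prop :=
  [/\ size j = k, all (fun l => (l < b)%N) j & last 0%N j != 0%N].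

Definition protasov_vertex (b : nat) (j : seq nat) : Prop :=
  exists2 k, (1 <= k)%N & protasov_level b k j.

Definition protasov_child (b : nat) (j j' : seq nat) : Prop :=
  exists2 l, (l < b)%N & j' = l :: j.

Definition protasov_blocking (b : nat) (B : {fset seq nat}) : Prop :=
  blocking (protasov_vertex b) (protasov_level b 1) (protasov_child b) B.

Definition word_val (b : nat) (j : seq nat) : nat :=
  (\sum_(i < size j) nth 0 (rev j) i * b ^ i)%N.

Definition tau (b : nat) (j : seq nat) : {poly int} :=
  'Phi_(b ^ size j %/ gcdn (word_val b j) (b ^ size j))%N.

Definition word_exp (R : realType) (b : nat) (j : seq nat) : R[i] :=
  let theta : R := 2 * pi * (word_val b j)%:R / b%:R ^+ size j in
  (cos theta +i* sin theta)%C.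

Definition symmetric_blocking (b : nat) (B : {fset seq nat}) : Prop :=
  protasov_blocking b B /\
  forall j j', j \in B -> protasov_vertex b j' -> tau b j' = tau b j -> j' \in B.

Definition vanishes_on (R : realType) (b : nat) (D : {fset nat})
    (B : {fset seq nat}) : Prop :=
  forall j, j \in B -> (digit_poly R[i] D).[word_exp R b j] = 0.

(* On {poly int}, %| is pseudo-divisibility; it is only used below with monic
   left arguments, for which it is divisibility in Z[x]. *)
Definition cyclotomic_factor (e : nat) (p : {poly int}) : Prop :=
  (0 < e)%N /\ 'Phi_e %| p.

Definition phi_top (b : nat) (p : {poly int}) : Prop :=
  exists d, [/\ (d %| b)%N, (1 < d)%N & p = 'Phi_d].

Definition phi_child (b : nat) (p q : {poly int}) : Prop :=
  exists2 e, cyclotomic_factor e (p \Po 'X^b) & q = 'Phi_e.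

Inductive phi_vertex (b : nat) : {poly int} -> Prop :=
| PhiTop p of phi_top b p : phi_vertex b p
| PhiChild p q of phi_vertex b p & phi_child b p q : phi_vertex b q.

Definition phi_blocking (b : nat) (N : {fset {poly int}}) : Prop :=
  blocking (phi_vertex b) (phi_top b) (phi_child b) N.

Definition kernel_poly (N : {fset {poly int}}) : {poly int} := \prod_(p <- N) p.

Definition shares_factor (b : nat) (D : {fset nat}) (t j : nat) : Prop :=
  exists2 s, cyclotomic_factor s ('Phi_t \Po 'X^(b ^ j)) &
    'Phi_s %| digit_poly int D.

(* j(t) = j, with j finite. *)
Definition first_index (b : nat) (D : {fset nat}) (t j : nat) : Prop :=
  shares_factor b D t j /\ forall i, shares_factor b D t i -> (j <= i)%N.

(* R_k(t) is meant for k >= 1; the value at k = 0 is a dummy. *)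
Fixpoint condR (b : nat) (D : {fset nat}) (k t : nat) : Prop :=
  match k with
  | 0 => False
  | 1 => exists j, ('Phi_t \Po 'X^(b ^ j)) %| digit_poly int D
  | k'.+1 => exists2 j, first_index b D t j &
      forall s, cyclotomic_factor s ('Phi_t \Po 'X^(b ^ j)) -> condR b D k' s
  end.

Definition condP (b : nat) (D : {fset nat}) (k : nat) : Prop :=
  forall d, (d %| b)%N -> (1 < d)%N -> condR b D k d.

(* Main.v *)
Require Import Defs.
From mathcomp Require Import all_boot all_order all_algebra finmap.
From mathcomp Require Import algC cyclotomic complex.
From mathcomp Require Import all_classical all_reals all_analysis.
From mathcomp Require Import zify ring lra.

Set Implicit Arguments.
Unset Strict Implicit.
Unset Printing Implicit Defensive.

Import Order.TTheory GRing.Theory Num.Theory numFieldNormedType.Exports.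

(** In the [Phi]-tree the parent of
    [Phi_e] is [Phi_(e / gcd(e, b))], and [tau] maps the Protasov word of [m] of
    length [k] to the cyclotomic polynomial of the order of [e(m / b^k)]; so both
    trees, and the conditions [(P_k)], are governed by the zeros of [P_D]
    along the sequences [e(m / b^k)], [k >= 1].

    (i) => (ii). If [T] has interior, counting the points [y / b^n] in [T] shows
    that the sums [\sum_(k < n) b^k d_k] are pairwise distinct, so the number
    [r_n x] of such sums congruent to [x] mod [b^n] is bounded. The [r_n] form a
    bounded integer-valued martingale on the [b]-adic integers; its increments
    tend to 0 in [L^2], hence in [L^1], which forces
    [\prod_(1 <= k <= n) P_D(e(m / b^k)) / b] to tend to 0 for each [m > 0].
    As the infinite product converges, one of its factors vanishes. [P_D] has
    finitely many cyclotomic factors, so the first zeros on the paths form a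
    finite symmetric blocking.

    (iv) => (i). A bound on the depth of the first zeros makes [r_n] invariant
    under translation by a fixed [b^L], by Fourier inversion on [Z / b^n]. So
    the integer translates of [T] have a dense union; [T] is closed, and Baire's
    theorem gives an interior point. *)

(** * Cyclotomic divisors and roots of unity *)

Local Open Scope ring_scope.

Lemma map_ratr_intr (F : numFieldType) (p : {poly int}) :
  map_poly (ratr : rat -> F) (map_poly intr p) = map_poly intr p.
Proof.
rewrite -map_poly_comp; apply: eq_map_poly => i /=.
exact: ratr_int.
Qed.

Lemma prim_root_root_Cyclotomic (F : numFieldType) n (z : F) :
  n.-primitive_root z -> root (map_poly intr 'Phi_n) z.
Proof.
move=> zn; have n0 := prim_order_gt0 zn.
have : root (map_poly intr (\prod_(d <- divisors n) 'Phi_d)) z.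
  rewrite prod_Cyclotomic // rmorphB /= map_polyXn rmorph1.
  by rewrite rootE !hornerE (prim_expr_order zn) subrr.
rewrite rmorph_prod rootE horner_prod prodf_seq_eq0 => /hasP[d]/=.
rewrite -dvdn_divisors // => dn dz.
have d0 : (0 < d)%N by apply: dvdn_gt0 dn.
have : root (map_poly intr ('X^d - 1 : {poly int})) z.
  rewrite -(prod_Cyclotomic d0) rmorph_prod rootE horner_prod prodf_seq_eq0.
  by apply/hasP; exists d => //=; rewrite -dvdn_divisors.
rewrite rmorphB /= map_polyXn rmorph1 rootE !hornerE subr_eq0.
rewrite -(prim_order_dvd zn) => nd.
by have <- : d = n by apply/eqP; rewrite eqn_dvd dn.
Qed.

Lemma Cyclotomic_dvdp_algC n (z : algC) (p : {poly int}) :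
  n.-primitive_root z -> ('Phi_n %| p) = root (map_poly intr p) z.
Proof.
move=> zn; have [q [qz _] qP] := minCpolyP z.
rewrite -dvdp_rat_int -(map_ratr_intr algC p) qP; congr (_ %| _).
apply: (map_poly_inj (ratr : {rmorphism rat -> algC})).
rewrite -qz map_ratr_intr (minCpoly_cyclotomic zn).
exact: Cintr_Cyclotomic zn.
Qed.

(** Decided by the gcd of ['Phi_n] and [p] over the rationals. If it is trivial, it stays so over
    [F] and [z] is no root of [p]; otherwise it has a root in [algC], where ['Phi_n] is a minimal
    polynomial. *)
Lemma Cyclotomic_dvdp (F : numFieldType) n (z : F) (p : {poly int}) :
  n.-primitive_root z -> ('Phi_n %| p) = root (map_poly intr p) z.
Proof.
move=> zn; apply/idP/idP => [|].
  rewrite -dvdp_rat_int -(map_ratr_intr F p) => /dvdpP[q ->].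
  rewrite rmorphM /= map_ratr_intr rootM.
  by rewrite prim_root_root_Cyclotomic ?orbT.
apply: contraLR => np.
suff cop : coprimep (map_poly (ratr : rat -> F) (map_poly intr 'Phi_n))
             (map_poly (ratr : rat -> F) (map_poly intr p)).
  rewrite -map_ratr_intr; apply: (coprimep_root cop).
  by rewrite map_ratr_intr prim_root_root_Cyclotomic.
rewrite coprimep_map; apply: contraR np => ncop.
set g := gcdp (map_poly intr 'Phi_n : {poly rat}) (map_poly intr p).
have [w gw] : exists w, root (map_poly (ratr : rat -> algC) g) w.
  by apply/closed_rootP; rewrite size_map_poly.
have rw q : g %| map_poly intr q -> root (map_poly intr q) w.
  by rewrite -(map_ratr_intr algC q) => /dvdpP[r ->]; rewrite rmorphM /= rootM gw orbT.
have [y yn] := C_prim_root_exists (prim_order_gt0 zn).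
have wn : n.-primitive_root w.
  rewrite -(root_cyclotomic yn) -(Cintr_Cyclotomic yn).
  exact: rw (dvdp_gcdl _ _).
by rewrite (Cyclotomic_dvdp_algC _ wn); apply: rw (dvdp_gcdr _ _).
Qed.

Lemma root_Cyclotomic (F : numFieldType) m n (z : F) :
  (0 < m)%N -> n.-primitive_root z -> root (map_poly intr 'Phi_m) z = (m == n).
Proof.
move=> m0 zn; apply/idP/eqP => [|->]; last exact: prim_root_root_Cyclotomic.
rewrite -(Cyclotomic_dvdp _ zn).
have [y yn] := C_prim_root_exists (prim_order_gt0 zn).
have [x xm] := C_prim_root_exists m0.
rewrite (Cyclotomic_dvdp_algC _ yn) (Cintr_Cyclotomic xm) (root_cyclotomic xm).
move=> ym; apply/eqP; rewrite eqn_dvd.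
by rewrite (prim_order_dvd ym) (prim_expr_order yn) (prim_order_dvd yn)
  (prim_expr_order ym) !eqxx.
Qed.

Lemma Cyclotomic_inj : {in [pred n | (0 < n)%N] &, injective Cyclotomic}.
Proof.
move=> m n /= m0 n0 mn; have [z zn] := C_prim_root_exists n0.
by apply/eqP; rewrite -(root_Cyclotomic m0 zn) mn prim_root_root_Cyclotomic.
Qed.

(** Distinct cyclotomic polynomials share no root: a primitive [e]-th root of unity is a root of [p]
    but not of the product already split off, hence of the cofactor. *)
Lemma prod_Cyclotomic_dvdp (s : seq {poly int}) (p : {poly int}) :
  uniq s -> {in s, forall q, q %| p /\ exists2 e, (0 < e)%N & q = 'Phi_e} ->
  \prod_(q <- s) q %| p.
Proof.
elim: s => [|f s ih] /=; first by rewrite big_nil dvd1p.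
move=> /andP[es us] H; rewrite big_cons.
have mon : \prod_(q <- s) q \is monic.
  rewrite big_seq; apply: rpred_prod => q qs.
  have [|_ [e _ ->]] := H q; first by rewrite inE qs orbT.
  exact: Cyclotomic_monic.
have /(Pdiv.IdomainMonic.dvdpP mon)[q pq] : \prod_(q <- s) q %| p.
  by apply: ih => // d ds; apply: H; rewrite inE ds orbT.
have [ep [e e0 fe]] := H _ (mem_head _ _); subst f.
suff /(Pdiv.IdomainMonic.dvdpP (Cyclotomic_monic _))[r qr] : 'Phi_e %| q.
  have monM : 'Phi_e * \prod_(q <- s) q \is monic.
    by rewrite monicMl ?Cyclotomic_monic.
  apply/(Pdiv.IdomainMonic.dvdpP monM).
  by exists r; rewrite pq qr mulrA.
have [z ze] := C_prim_root_exists e0.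
move: ep; rewrite !(Cyclotomic_dvdp _ ze) pq rmorphM rootM /= => /orP[//|].
rewrite rmorph_prod rootE horner_prod prodf_seq_eq0 => /hasP[f fs /=].
have [|_ [d d0 fd]] := H f; first by rewrite inE fs orbT.
subst f; rewrite -/(root _ _) (root_Cyclotomic d0 ze).
by move=> /eqP de; rewrite -de fs in es.
Qed.

Lemma digit_poly_map (F : numFieldType) (D : {fset nat}) :
  map_poly intr (digit_poly int D) = digit_poly F D.
Proof.
rewrite /digit_poly rmorph_sum; apply: eq_bigr => d _ /=.
by rewrite map_polyXn.
Qed.

Lemma digit_poly_neq0 (D : {fset nat}) : #|` D|%fset != 0%N -> digit_poly int D != 0.
Proof.
apply: contraNneq => D0; have : (digit_poly int D).[1] = 0 by rewrite D0 horner0.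
rewrite /digit_poly horner_sum (eq_bigr (fun=> 1)) => [|d _]; last first.
  by rewrite hornerXn expr1n.
by rewrite big_const_seq count_predT iter_addr_0 => /eqP; rewrite pnatr_eq0.
Qed.

(** * Levels of the [Phi]-tree and orders of roots of unity *)

Local Open Scope nat_scope.

(* The index of the cyclotomic polynomial j levels above 'Phi_e in the
   Phi-tree; it is 1 from the root on. *)
Definition ancestor (b j e : nat) : nat := e %/ gcdn e (b ^ j).

(* The order of the root of unity e(m / b ^ k). *)
Definition exp_order (b m k : nat) : nat := b ^ k %/ gcdn m (b ^ k).

Section Ancestors.
Variable (b : nat).
Hypothesis b_gt1 : 1 < b.

Let bX_gt0 k : 0 < b ^ k. Proof. by rewrite expn_gt0 ltnW. Qed.

Lemma ancestor_gt0 j e : 0 < e -> 0 < ancestor b j e.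
Proof. by move=> e0; rewrite divn_gt0 ?gcdn_gt0 ?e0 // dvdn_leq ?dvdn_gcdl. Qed.

Lemma ancestor0 e : ancestor b 0 e = e.
Proof. by rewrite /ancestor gcdn1 divn1. Qed.

Lemma prim_root_ancestor (F : numFieldType) j e (z : F) :
  (e.-primitive_root z -> (ancestor b j e).-primitive_root (z ^+ (b ^ j)))%R.
Proof. by move=> ze; rewrite /ancestor gcdnC; exact: exp_prim_root. Qed.

Lemma prim_root_unique (F : numFieldType) m n (z : F) :
  m.-primitive_root%R z -> n.-primitive_root%R z -> m = n.
Proof.
move=> zm zn; apply/eqP; rewrite eqn_dvd.
by rewrite (prim_order_dvd zm) (prim_expr_order zn) (prim_order_dvd zn)
  (prim_expr_order zm) !eqxx.
Qed.

Lemma ancestorD i j e : 0 < e -> ancestor b i (ancestor b j e) = ancestor b (j + i) e.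
Proof.
move=> e0; have [z ze] := C_prim_root_exists e0.
have := prim_root_ancestor i (prim_root_ancestor j ze).
rewrite -exprM -expnD => /prim_root_unique; apply.
exact: prim_root_ancestor.
Qed.

Lemma ancestor_eq1 j e : 0 < e -> (ancestor b j e == 1) = (e %| b ^ j).
Proof.
move=> e0; apply/eqP/idP => [e1|/gcdn_idPl eb].
  have := divnK (dvdn_gcdl e (b ^ j)); rewrite -/(ancestor b j e) e1 mul1n => <-.
  exact: dvdn_gcdr.
by rewrite /ancestor eb divnn e0.
Qed.

Lemma exp_order_gt0 m k : 0 < exp_order b m k.
Proof.
rewrite divn_gt0; last by rewrite gcdn_gt0 bX_gt0 orbT.
by rewrite dvdn_leq ?dvdn_gcdr.
Qed.

Lemma exp_order_dvd m k : exp_order b m k %| b ^ k.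
Proof. by rewrite /exp_order dvdn_div ?dvdn_gcdr. Qed.

Lemma prim_root_exp_order (F : numFieldType) m k (z : F) :
  ((b ^ k).-primitive_root z -> (exp_order b m k).-primitive_root (z ^+ m))%R.
Proof. by move=> zk; exact: exp_prim_root. Qed.

Lemma ancestor_exp_order j m k : ancestor b j (exp_order b m (k + j)) = exp_order b m k.
Proof.
have [z zk] := C_prim_root_exists (bX_gt0 (k + j)).
have := prim_root_ancestor j (prim_root_exp_order m zk).
rewrite exprAC => /prim_root_unique; apply; apply: prim_root_exp_order.
have := dvdn_prim_root zk (dvdn_exp2l b (leq_addr j k)).
by rewrite expnD mulKn.
Qed.

Lemma exp_order_eq1 m k : (exp_order b m k == 1) = (b ^ k %| m).
Proof.
have [z zk] := C_prim_root_exists (bX_gt0 k).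
rewrite (prim_order_dvd zk); have zm := prim_root_exp_order m zk.
apply/eqP/eqP => [m1|zm1]; first by rewrite m1 in zm; rewrite -(prim_expr_order zm) expr1.
apply/eqP; rewrite -dvdn1 (prim_order_dvd zm) zm1 expr1; exact/eqP.
Qed.

Lemma exp_order_div e k : e %| b ^ k -> exp_order b (b ^ k %/ e) k = e.
Proof.
move=> ek; rewrite /exp_order; have /gcdn_idPl -> : b ^ k %/ e %| b ^ k by exact: dvdn_div.
by rewrite divnA // mulKn.
Qed.

Lemma exp_order_mod m k : exp_order b (m %% b ^ k) k = exp_order b m k.
Proof. by rewrite /exp_order gcdn_modl. Qed.

(** For [k = 1] this locates the level: if [b] does not divide [m], the order at level [j + 1]
    divides [b ^ (j + 1)] but not [b ^ j]. *)
Lemma exp_order_dvdX m k j : (exp_order b m (k + j) %| b ^ j) = (b ^ k %| m).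
Proof. by rewrite -ancestor_eq1 ?exp_order_gt0 // ancestor_exp_order exp_order_eq1. Qed.

Lemma cyclotomic_factorP t j e : 0 < t ->
  cyclotomic_factor e ('Phi_t \Po 'X^(b ^ j))%R <-> 0 < e /\ ancestor b j e = t.
Proof.
move=> t0; split=> -[e0]; have [z ze] := C_prim_root_exists e0; have za := prim_root_ancestor j ze.
  rewrite (Cyclotomic_dvdp _ ze) map_comp_poly map_polyXn root_comp hornerXn.
  by rewrite (root_Cyclotomic t0 za) eq_sym => /eqP.
move=> <-; split=> //; rewrite (Cyclotomic_dvdp _ ze) map_comp_poly map_polyXn root_comp hornerXn.
exact: prim_root_root_Cyclotomic.
Qed.

End Ancestors.

(** * Depth of the cyclotomic divisors of a polynomial *)

Lemma logn_le_totient p e : 0 < e -> logn p e <= totient e.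
Proof.
move=> e0; have [pp|np] := boolP (prime p); last by rewrite lognE (negbTE np).
have [/eqP ->//|a0] := boolP (logn p e == 0).
have [n cop en] := pfactor_coprime pp e0.
have n0 : 0 < n by rewrite lt0n; apply: contraTneq cop => ->; rewrite /coprime gcdn0 gtn_eqF ?prime_gt1.
have -> : totient e = totient n * totient (p ^ logn p e).
  by rewrite {1}en totient_coprime // coprimeXr // coprime_sym.
rewrite totient_pfactor ?lt0n //.
(* With [a = logn p e], the factor [(p - 1) * p ^ (a - 1)] is at least [p ^ (a - 1)], hence at least
   [a]. *)
apply: (@leq_trans (1 * (1 * p ^ (logn p e).-1))); last first.
  by rewrite leq_mul ?totient_gt0 // leq_mul // -ltnS prednK ?prime_gt0 ?prime_gt1.
rewrite !mul1n; rewrite -lt0n in a0; rewrite -[leqLHS](prednK a0).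
exact: ltn_expl (prime_gt1 pp).
Qed.

(** The degree of ['Phi_e] is [totient e], which bounds every prime exponent of [e], and the primes
    of [e] divide [b]. Hence only boundedly many levels contain divisors of [p]. *)
Lemma Cyclotomic_dvdp_bound (b e k : nat) (p : {poly int}) :
  1 < b -> p != 0%R -> e %| b ^ k -> ('Phi_e %| p)%R -> e %| b ^ size p.
Proof.
move=> b1 p0 ek ep; have b0 : 0 < b by exact: ltnW.
have e0 : 0 < e by apply: dvdn_gt0 ek; rewrite expn_gt0 b0.
have : totient e < size p.
  rewrite -size_Cyclotomic; move: ep.
  move=> /(Pdiv.IdomainMonic.dvdpP (Cyclotomic_monic e))[q pq].
  have q0 : q != 0%R by apply: contraNneq p0 => q0; rewrite pq q0 mul0r.
  rewrite pq size_Mmonic ?Cyclotomic_monic // size_Cyclotomic.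
  by move: q0; rewrite -size_poly_gt0; case: (size q) => // m _; rewrite addSn /= leq_addl.
move=> te; apply/dvdn_partP => // q qe; rewrite p_part pfactor_dvdn; last by rewrite expn_gt0 b0.
  rewrite lognX (leq_trans (logn_le_totient q e0)) // (leq_trans (ltnW te)) //.
  rewrite leq_pmulr // logn_gt0 mem_primes b0.
  move: qe; rewrite mem_primes => /and3P[pq _ qe]; rewrite pq /=.
  by have := dvdn_trans qe ek; rewrite Euclid_dvdX // => /andP[].
by move: qe; rewrite mem_primes => /and3P[].
Qed.

(** * The two trees *)

Section Trees.
Variable (b : nat).
Hypothesis b_gt1 : 1 < b.

Let b_gt0 : 0 < b. Proof. exact: ltnW. Qed.
Let bX_gt0 k : 0 < b ^ k. Proof. by rewrite expn_gt0 b_gt0. Qed.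

Lemma exp_order_level m n k l : ~~ (b %| m) -> ~~ (b %| n) ->
  exp_order b m k.+1 = exp_order b n l.+1 -> k = l.
Proof.
suff lt m' n' k' l' : ~~ (b %| n') -> k' < l' ->
    exp_order b m' k'.+1 <> exp_order b n' l'.+1.
  move=> bm bn mn; case: (ltngtP k l) => // kl; last by have := lt _ _ _ _ bm kl (esym mn).
  by have := lt _ _ _ _ bn kl mn.
move=> bn kl mn; move/negP: bn; apply.
have := exp_order_dvdX b_gt1 n' 1 l'; rewrite add1n expn1 => <-; rewrite -mn.
by apply: dvdn_trans (exp_order_dvd _ _ _) _; exact: dvdn_exp2l.
Qed.

Lemma exp_order_neq1 m k : ~~ (b %| m) -> exp_order b m k.+1 != 1.
Proof.
rewrite exp_order_eq1 //; apply: contraNN; apply: dvdn_trans.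
by rewrite expnS dvdn_mulr.
Qed.

Lemma exp_order_gt1 m k : ~~ (b %| m) -> 1 < exp_order b m k.+1.
Proof. by move=> bm; rewrite ltn_neqAle eq_sym exp_order_neq1 // exp_order_gt0. Qed.

Lemma ancestor_exp_order_le m i k : i <= k ->
  ancestor b (k - i) (exp_order b m k.+1) = exp_order b m i.+1.
Proof. by move=> ik; rewrite -(ancestor_exp_order b_gt1 (k - i) m i.+1) addSn subnKC. Qed.

Lemma exp_order_child m k :
  cyclotomic_factor (exp_order b m k.+2) ('Phi_(exp_order b m k.+1) \Po 'X^b)%R.
Proof.
have /= := cyclotomic_factorP b 1 (exp_order b m k.+2) (exp_order_gt0 b_gt1 m k.+1).
rewrite expn1 => -[_]; apply; split; first exact: exp_order_gt0.
by rewrite -(ancestor_exp_order b_gt1 1 m k.+1) addn1.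
Qed.

Lemma vertex_exp_order e k : e %| b ^ k.+1 -> ~~ (e %| b ^ k) ->
  exists2 m, ~~ (b %| m) & e = exp_order b m k.+1.
Proof.
move=> ek nek; exists (b ^ k.+1 %/ e); last by rewrite exp_order_div.
apply: contraNN nek => bm; rewrite -{1}(exp_order_div b_gt1 ek).
by have := exp_order_dvdX b_gt1 (b ^ k.+1 %/ e) 1 k; rewrite add1n expn1 => ->.
Qed.

Lemma exp_order_phi_path m : ~~ (b %| m) ->
  infinite_path (phi_top b) (phi_child b) (fun n => 'Phi_(exp_order b m n.+1)%R).
Proof.
move=> bm; split=> [|n].
  exists (exp_order b m 1); split=> //; last exact: exp_order_gt1.
  by have := exp_order_dvd b m 1; rewrite expn1.
by exists (exp_order b m n.+2) => //; exact: exp_order_child.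
Qed.

(** A prefix is determined by its last vertex, so one [m] describes it. The bound [K] is there
    because in general only a [b]-adic integer describes a whole path. *)
Lemma phi_path_exp_order p K : infinite_path (phi_top b) (phi_child b) p ->
  exists2 m, ~~ (b %| m) & forall i, i <= K -> p i = 'Phi_(exp_order b m i.+1)%R.
Proof.
move=> [[d [db d1 p0]] pS].
suff [e [e0 eK neK pe]] : exists e, [/\ 0 < e, e %| b ^ K.+1, ~~ (e %| b ^ K)
    & forall i, i <= K -> p i = 'Phi_(ancestor b (K - i) e)%R].
  have [m bm em] := vertex_exp_order eK neK.
  by exists m => // i iK; rewrite pe // em ancestor_exp_order_le.
elim: K => [|K [e [e0 eK neK pe]]].
  exists d; split; rewrite ?expn1 ?dvdn1 ?gtn_eqF //; first exact: ltnW.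
  by move=> i; rewrite leqn0 => /eqP ->; rewrite ancestor0.
have [e' + pe'] := pS K; rewrite pe // subnn ancestor0 -{1}(expn1 b).
move=> /(cyclotomic_factorP b _ _ e0)[e'0 ee'].
have anc j : ancestor b j.+1 e' = ancestor b j e by rewrite -ee' ancestorD // add1n.
exists e'; split=> //.
- by rewrite -ancestor_eq1 // anc ancestor_eq1.
- by rewrite -ancestor_eq1 // anc ancestor_eq1.
move=> i; rewrite leq_eqVlt => /orP[/eqP ->|iK]; first by rewrite subnn ancestor0.
by rewrite subSn // anc pe.
Qed.

Lemma phi_vertex_exp_order m k : ~~ (b %| m) -> phi_vertex b 'Phi_(exp_order b m k.+1)%R.
Proof.
move=> bm; have [t c] := exp_order_phi_path bm.
by elim: k => [|k ih]; [exact: PhiTop t | exact: PhiChild ih (c k)].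
Qed.

(** * Protasov words as truncated base-[b] expansions *)

Fixpoint low_digits (m n : nat) : seq nat :=
  if n is n'.+1 then (m %/ b ^ n') %% b :: low_digits m n' else [::].

Lemma size_low_digits m n : size (low_digits m n) = n.
Proof. by elim: n => //= n ->. Qed.

Lemma low_digits_lt m n : all (fun l => l < b) (low_digits m n).
Proof. by elim: n => //= n ->; rewrite ltn_mod b_gt0. Qed.

Lemma last_low_digits m n x : last x (low_digits m n.+1) = m %% b.
Proof. by elim: n x => [|n ih] x; [rewrite /= divn1 | exact: ih]. Qed.

Lemma word_val_cons l j : word_val b (l :: j) = word_val b j + l * b ^ size j.
Proof.
rewrite /word_val /= big_ord_recr /= rev_cons nth_rcons size_rev ltnn eqxx.
by congr (_ + _); apply: eq_bigr => i _; rewrite nth_rcons size_rev ltn_ord.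
Qed.

Lemma modn_expS m n : m %% b ^ n.+1 = m %% b ^ n + (m %/ b ^ n) %% b * b ^ n.
Proof.
rewrite {1}(divn_eq m (b ^ n)) {1}(divn_eq (m %/ b ^ n) b).
rewrite mulnDl -mulnA -expnS -addnA modnMDl addnC modn_small //.
have : m %% b ^ n < b ^ n by rewrite ltn_mod.
have : (m %/ b ^ n) %% b < b by rewrite ltn_mod.
rewrite expnS; nia.
Qed.

Lemma word_val_low_digits m n : word_val b (low_digits m n) = m %% b ^ n.
Proof.
elim: n => [|n ih] /=; first by rewrite modn1 /word_val big_ord0.
by rewrite word_val_cons ih size_low_digits modn_expS.
Qed.

Lemma eq_low_digits m m' n : m = m' %[mod b ^ n] -> low_digits m n = low_digits m' n.
Proof.
elim: n => //= n ih mm'; congr (_ :: _).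
  have e k : (k %/ b ^ n) %% b = (k %% b ^ n.+1) %/ b ^ n.
    by rewrite modn_expS addnC divnMDl // [X in _ = _ + X]divn_small ?ltn_mod ?addn0.
  by rewrite !e mm'.
by apply: ih; rewrite -(modn_dvdm m (dvdn_exp2l b (leqnSn n))) mm' modn_dvdm ?dvdn_exp2l.
Qed.

Lemma low_digits_exp_order m m' n : low_digits m n = low_digits m' n ->
  exp_order b m n = exp_order b m' n.
Proof.
by move=> mm'; rewrite -exp_order_mod -word_val_low_digits mm' word_val_low_digits exp_order_mod.
Qed.

Lemma low_digits_mod m n : low_digits (m %% b ^ n) n = low_digits m n.
Proof. by apply: eq_low_digits; rewrite modn_mod. Qed.

Lemma low_digits_surj j : all (fun l => l < b) j ->
  low_digits (word_val b j) (size j) = j.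
Proof.
elim: j => //= l j ih /andP[lb jb]; have vj : word_val b j < b ^ size j.
  by rewrite -[in X in X < _](ih jb) word_val_low_digits ltn_mod.
rewrite word_val_cons addnC divnMDl // divn_small // addn0 modn_small //.
by congr (_ :: _); rewrite -[RHS](ih jb); apply: eq_low_digits; rewrite modnMDl.
Qed.

Lemma protasov_level_low_digits m k : ~~ (b %| m) ->
  protasov_level b k.+1 (low_digits m k.+1).
Proof.
move=> bm; split; first exact: size_low_digits.
  exact: low_digits_lt.
by rewrite last_low_digits.
Qed.

Lemma protasov_vertexP j : protasov_vertex b j ->
  exists m k, ~~ (b %| m) /\ j = low_digits m k.+1.
Proof.
case=> -[//|k] _ [sj jb lj]; exists (word_val b j), k.
have jE : j = low_digits (word_val b j) k.+1 by rewrite -sj low_digits_surj.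
by split=> //; move: lj; rewrite {1}jE last_low_digits.
Qed.

Lemma protasov_vertex_low_digits m k : ~~ (b %| m) -> protasov_vertex b (low_digits m k.+1).
Proof. by move=> bm; exists k.+1 => //; exact: protasov_level_low_digits. Qed.

Lemma low_digits_protasov_path m : ~~ (b %| m) ->
  infinite_path (protasov_level b 1) (protasov_child b) (fun n => low_digits m n.+1).
Proof.
move=> bm; split; first exact: protasov_level_low_digits.
by move=> n; exists ((m %/ b ^ n.+1) %% b) => //; rewrite ltn_mod.
Qed.

Lemma protasov_path_low_digits q K :
  infinite_path (protasov_level b 1) (protasov_child b) q ->
  exists2 m, ~~ (b %| m) & forall i, i <= K -> q i = low_digits m i.+1.
Proof.
move=> [q0 qS].
have lev n : protasov_level b n.+1 (q n).
  elim: n => // n [sq bq lq]; have [l lb ->] := qS n.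
  by split; rewrite /= ?sq ?lb //; case: (q n) sq lq.
have [|m [k [bm qK]]] := @protasov_vertexP (q K); first by exists K.+1.
have kK : k = K by have [sq _ _] := lev K; move: sq; rewrite qK size_low_digits => -[].
rewrite {}kK in qK; exists m => // i iK; rewrite -(subKn iK).
elim: (K - i) (leq_subr i K) => [|n ih] nK; first by rewrite subn0.
rewrite (subnSK nK); have [l _] := qS (K - n.+1).
by rewrite subnSK // ih ?(ltnW nK) // => -[_ ->].
Qed.

Lemma tau_low_digits m k : tau b (low_digits m k) = 'Phi_(exp_order b m k)%R.
Proof. by rewrite /tau size_low_digits word_val_low_digits -/(exp_order _ _ _) exp_order_mod. Qed.

End Trees.

(** * From blockings to condition (P_k) *)

Section Implications.
Variables (b : nat) (D : {fset nat}).
Hypothesis b_gt1 : 1 < b.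
Hypothesis card_D : #|` D|%fset = b.

Let b_gt0 : 0 < b. Proof. exact: ltnW. Qed.
Let bX_gt0 k : 0 < b ^ k. Proof. by rewrite expn_gt0 b_gt0. Qed.

Let P : {poly int} := digit_poly int D.

Let P_neq0 : P != 0%R.
Proof. by apply: digit_poly_neq0; rewrite card_D -lt0n. Qed.

Let zero (e : nat) : bool := ('Phi_e %| P)%R.

Let exp_order_dvd_pred m k : ~~ (b %| m) -> ~~ (exp_order b m k.+1 %| b ^ k).
Proof. by have := exp_order_dvdX b_gt1 m 1 k; rewrite add1n expn1 => ->. Qed.

(** The order at level [k + 1] does not divide [b ^ k], while that of a zero divides
    [b ^ size P]. *)
Lemma zero_level m k : ~~ (b %| m) -> zero (exp_order b m k.+1) -> k < size P.
Proof.
move=> bm zk; rewrite ltnNge; apply/negP => Pk.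
have := Cyclotomic_dvdp_bound b_gt1 P_neq0 (exp_order_dvd b m k.+1) zk.
move=> /dvdn_trans /(_ (dvdn_exp2l b Pk)); apply/negP; exact: exp_order_dvd_pred.
Qed.

(** Stated on the index alone, so words with equal [tau] are first zeros together;
    [ancestor b j e != 1] excludes the root. *)
Definition first_zero (e : nat) : Prop :=
  zero e /\ forall j, 0 < j -> ancestor b j e != 1 -> ~~ zero (ancestor b j e).

Lemma first_zero_exp_order m k : ~~ (b %| m) -> zero (exp_order b m k.+1) ->
  (forall i, i < k -> ~~ zero (exp_order b m i.+1)) -> first_zero (exp_order b m k.+1).
Proof.
move=> bm zk zi; split=> // j j0.
have [jk _|kj] := leqP j k.
  rewrite -{1}(subKn jk) ancestor_exp_order_le ?leq_subr //; apply: zi; lia.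
rewrite ancestor_eq1 ?exp_order_gt0 // => /negP[].
exact: dvdn_trans (exp_order_dvd _ _ _) (dvdn_exp2l b kj).
Qed.

Lemma first_zero_inj m k l : ~~ (b %| m) ->
  first_zero (exp_order b m k.+1) -> first_zero (exp_order b m l.+1) -> k = l.
Proof.
suff lt k' l' : ~~ (b %| m) -> zero (exp_order b m k'.+1) ->
    first_zero (exp_order b m l'.+1) -> ~~ (k' < l').
  move=> bm fk fl; apply/eqP; rewrite eqn_leq leqNgt (lt _ _ bm fl.1 fk) leqNgt.
  by rewrite (lt _ _ bm fk.1 fl).
move=> bm zk [_ fl]; apply/negP => kl.
have := fl (l' - k'); rewrite ancestor_exp_order_le // ?(ltnW kl) //.
by rewrite zk subn_gt0 kl exp_order_neq1 // => /(_ isT isT).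
Qed.

(** The blocking consists of the words of first zeros: symmetric because [first_zero] depends on the
    order only, finite because zeros have bounded level. *)
Lemma symmetric_blocking_of_zeros :
  (forall m, 0 < m -> exists2 k, 0 < k & zero (exp_order b m k)) ->
  exists2 B : {fset seq nat}, symmetric_blocking b B &
    forall j, j \in B -> exists m k,
      [/\ ~~ (b %| m), j = low_digits b m k.+1 & zero (exp_order b m k.+1)].
Proof.
move=> core.
pose inB j := exists m k, [/\ ~~ (b %| m), j = low_digits b m k.+1 &
  first_zero (exp_order b m k.+1)].
(* A finite list containing all words of length 1 to [size P], from which the first zeros are
   selected. *)
pose s := [seq low_digits b m k.+1 | k <- iota 0 (size P), m <- iota 0 (b ^ k.+1)].
pose B := [fset j in s | `[< inB j >]]%fset.
have BP j : j \in B <-> inB j.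
  rewrite /B !inE /=; split=> [/andP[_ /asboolP//]|jB]; apply/andP; split; last exact/asboolP.
  have [m [k [bm -> [zk _]]]] := jB; apply/allpairsPdep; exists k, (m %% b ^ k.+1).
  by rewrite !mem_iota !add0n ltn_mod bX_gt0 low_digits_mod // (zero_level bm zk).
have pathB m : ~~ (b %| m) -> exists2 k, k < size P & first_zero (exp_order b m k.+1).
  move=> bm; have m0 : 0 < m by rewrite lt0n; apply: contraNneq bm => ->; rewrite dvdn0.
  have ex : exists k, zero (exp_order b m k.+1).
    by have [[//|k] _ zk] := core m m0; exists k.
  case: (ex_minnP ex) => k zk mink; exists k; first exact: zero_level zk.
  apply: first_zero_exp_order => // i ik; apply/negP => /mink; lia.
exists B; last first.
  by move=> j /BP[m [k [bm -> [zk _]]]]; exists m, k.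
split; first split.
- by move=> j /BP[m [k [bm -> _]]]; exact: protasov_vertex_low_digits.
- move=> q qpath; have [m bm qm] := protasov_path_low_digits b_gt1 (size P) qpath.
  have [k kP fk] := pathB m bm; exists k; split=> [|n].
    by apply/BP; exists m, k; rewrite qm // ltnW.
  move=> /BP[m' [n' [bm' qn fn']]].
  have [m'' _ qm''] := protasov_path_low_digits b_gt1 n qpath.
  have nn' : n = n'.
    by move: (qn); rewrite qm'' // => /(congr1 size); rewrite !size_low_digits => -[].
  rewrite -{}nn' in qn fn'; have nP := zero_level bm' fn'.1.
  rewrite qm ?(ltnW nP) // in qn.
  rewrite -(low_digits_exp_order b_gt1 qn) in fn'.
  exact: first_zero_inj fk fn'.
move=> j j' /BP[m [k [bm -> fk]]] /(protasov_vertexP b_gt1)[m' [k' [bm' ->]]].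
rewrite !tau_low_digits // => /Cyclotomic_inj mm'; apply/BP; exists m', k'; split=> //.
by rewrite mm' // !inE exp_order_gt0.
Qed.

(** The [Phi]-blocking is the image of [B] under [tau]. A [Phi]-path lies over the Protasov path of
    some [m], which meets [B]; by symmetry, every vertex of the image on the [Phi]-path comes from a
    word of [m] in [B], whence uniqueness. *)
Lemma phi_blocking_of_symmetric (B : {fset seq nat}) :
  symmetric_blocking b B ->
  (forall m k, ~~ (b %| m) -> low_digits b m k.+1 \in B -> zero (exp_order b m k.+1)) ->
  exists N : {fset {poly int}}, phi_blocking b N /\ (kernel_poly N %| digit_poly int D)%R.
Proof.
move=> [[Bv Bpath] Bsym] Bzero.
pose N := [fset tau b j | j in B]%fset.
have NP p : p \in N -> exists m k, [/\ ~~ (b %| m), low_digits b m k.+1 \in B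
    & p = 'Phi_(exp_order b m k.+1)%R].
  move=> /imfsetP[j jB ->]; have [m [k [bm je]]] := protasov_vertexP b_gt1 (Bv _ jB).
  by exists m, k; rewrite -je jB je tau_low_digits.
exists N; split; last first.
  apply: prod_Cyclotomic_dvdp; first exact: fset_uniq.
  move=> p /NP[m [k [bm mB ->]]]; split; first exact: Bzero.
  by exists (exp_order b m k.+1) => //; exact: exp_order_gt0.
split; first by move=> p /NP[m [k [bm mB ->]]]; exact: phi_vertex_exp_order.
move=> p ppath; pose K := size P.
have [m bm pm] := phi_path_exp_order b_gt1 K ppath.
have [n [nB nuniq]] := Bpath _ (low_digits_protasov_path b_gt1 bm).
have nK := zero_level bm (Bzero _ _ bm nB).
exists n; split.
  by apply/imfsetP; exists (low_digits b m n.+1); rewrite ?tau_low_digits // pm // ltnW.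
move=> l /NP[m' [k' [bm' kB pl]]]; apply: nuniq.
have [m'' bm'' pm''] := phi_path_exp_order b_gt1 l ppath.
have lk : l = k'.
  move: (pl); rewrite pm'' // => /Cyclotomic_inj; rewrite !inE => e.
  by apply: (exp_order_level b_gt1 bm'' bm'); rewrite e // exp_order_gt0.
rewrite -{}lk in kB pl; have lK := zero_level bm' (Bzero _ _ bm' kB).
apply: (Bsym _ _ kB); first exact: protasov_vertex_low_digits.
by rewrite !tau_low_digits // -pl pm // ltnW.
Qed.

(** Here [j(t) = 0], and ['Phi_t] has no cyclotomic factor but itself, so the recursion returns to
    [t]. *)
Lemma condR_zero c t : 0 < c -> 0 < t -> zero t -> condR b D c t.
Proof.
case: c => // c _ t0 zt; elim: c => [|c ih].
  by exists 0; rewrite expn0 expr1 comp_polyXr.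
exists 0.
  split=> //; exists t => //.
  by have [_] := cyclotomic_factorP b 0 t t0; apply; rewrite ancestor0.
by move=> s /(cyclotomic_factorP b _ _ t0)[_]; rewrite ancestor0 => ->.
Qed.

Lemma condP_of_phi_blocking (N : {fset {poly int}}) :
  phi_blocking b N -> (kernel_poly N %| digit_poly int D)%R ->
  exists k, 1 <= k /\ condP b D k.
Proof.
move=> [Nv Npath] Ndvd.
have Nzero e : 'Phi_e%R \in N -> zero e.
  move=> eN; rewrite /zero; apply: dvdp_trans Ndvd.
  by rewrite /kernel_poly (bigD1_seq _ eN) ?fset_uniq //= dvdp_mulIl.
(* [r] bounds the levels below [k + 1] where zeros remain possible, and each recursive call of
   [condR] descends at least one level; [N] has not been met above level [k + 1]. *)
have main r m k c : ~~ (b %| m) -> size P <= k.+1 + r -> r < c ->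
    (forall i, i < k -> 'Phi_(exp_order b m i.+1)%R \notin N) ->
    condR b D c (exp_order b m k.+1).
  elim: r m k c => [|r ih] m k c bm Pk rc kN;
      set t := exp_order b m k.+1; have t0 : 0 < t by exact: exp_order_gt0.
    have [n [nN _]] := Npath _ (exp_order_phi_path b_gt1 bm).
    have nP := zero_level bm (Nzero _ nN).
    have [nk|kn] := ltnP n k; first by rewrite (negbTE (kN _ nk)) in nN.
    apply: condR_zero => //; apply: Nzero.
    by have nk : n = k by [lia]; rewrite nk in nN.
  have [zt|nzt] := boolP (zero t); first by apply: condR_zero => //; lia.
  have tN : 'Phi_t%R \notin N by apply: contraNN nzt; exact: Nzero.
  have kN' i : i <= k -> 'Phi_(exp_order b m i.+1)%R \notin N.
    by rewrite leq_eqVlt => /orP[/eqP -> //|]; exact: kN.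
  have [n [nN _]] := Npath _ (exp_order_phi_path b_gt1 bm).
  have [nk|kn] := leqP n k; first by rewrite (negbTE (kN' _ nk)) in nN.
  have ex : exists j, `[< shares_factor b D t j >].
    exists (n - k); apply/asboolP; exists (exp_order b m n.+1); last exact: Nzero.
    have [_] := cyclotomic_factorP b (n - k) (exp_order b m n.+1) t0; apply.
    by rewrite exp_order_gt0 // ancestor_exp_order_le // ltnW.
  case: (ex_minnP ex) => j /asboolP jsh jmin.
  have j0 : 0 < j.
    rewrite lt0n; apply: contraNneq nzt => j0; rewrite j0 in jsh.
    by have [s /(cyclotomic_factorP b _ _ t0)[_]] := jsh; rewrite ancestor0 => ->.
  case: c rc => [//|[//|c]] rc; exists j.
    by split=> // i ish; apply: jmin; exact/asboolP.
  move=> s /(cyclotomic_factorP b _ _ t0)[s0 sj].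
  have sdvd i : (s %| b ^ (j + i)) = (t %| b ^ i).
    by rewrite -!ancestor_eq1 // -sj ancestorD.
  have [||m' bm' sm'] := @vertex_exp_order b b_gt1 s (k + j).
  - by rewrite -addnS addnC addSnnS sdvd exp_order_dvd.
  - by rewrite addnC sdvd exp_order_dvd_pred.
  have tm' : exp_order b m' k.+1 = t.
    by rewrite -sj sm' -(ancestor_exp_order_le b_gt1 m' (leq_addr j k)) addKn.
  rewrite sm'; apply: ih => //; [lia|].
  (* Up to level [k + 1] the [Phi]-paths of [m] and [m'] agree; strictly between levels [k + 1] and
     [k + j + 1] there is no zero below [t], by minimality of [j = j(t)]. *)
  move=> i ikj; have [ik|ki] := leqP i k.
    by rewrite -(ancestor_exp_order_le b_gt1 m' ik) tm' ancestor_exp_order_le // kN'.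
  apply/negP => /Nzero zi.
  have : `[< shares_factor b D t (i - k) >].
    apply/asboolP; exists (exp_order b m' i.+1) => //.
    have [_] := cyclotomic_factorP b (i - k) (exp_order b m' i.+1) t0; apply.
    by rewrite exp_order_gt0 // ancestor_exp_order_le // ltnW.
  by move=> /jmin; lia.
exists (size P).+1; split=> // d db d1.
have [||m bm ->] := @vertex_exp_order b b_gt1 d 0; rewrite ?expn1 ?dvdn1 ?gtn_eqF //.
by apply: (main (size P)) => //; lia.
Qed.

(** * From condition (P_k) to zeros at bounded depth *)

Lemma uniform_bound (Q : nat -> nat -> Prop) A :
  (forall s, s < A -> exists L, forall l, L <= l -> Q s l) ->
  exists L, forall s l, s < A -> L <= l -> Q s l.
Proof.
elim: A => [|A ih] H; first by exists 0.
have [s sA|L HL] := ih; first by apply: H; exact: ltnW.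
have [L' HL'] := H A (leqnn _).
exists (maxn L L') => s l; rewrite ltnS leq_eqVlt geq_max => /orP[/eqP ->|sA] /andP[Ll L'l].
  exact: HL'.
exact: HL.
Qed.

(** Every branch below [t] meets a zero within a fixed depth. For [c = 1], all vertices [j] levels
    below [t] are zeros; for larger [c], a common depth is taken over those finitely many
    vertices. *)
Lemma condR_bound c t : 0 < t -> condR b D c t ->
  exists L, forall l, L <= l -> forall s, 0 < s -> ancestor b l s = t ->
    exists2 i, i <= l & zero (ancestor b i s).
Proof.
elim: c t => // -[_ t t0 [j jt]|c ih t t0 [j _ jt]].
  exists j => l jl s s0 sl; exists (l - j); first exact: leq_subr.
  apply: dvdp_trans jt.
  have [|//] := (cyclotomic_factorP b j (ancestor b (l - j) s) t0).2.
  by rewrite ancestor_gt0 // ancestorD // subnK.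
pose Q s' l := 0 < s' -> ancestor b j s' = t -> forall s, 0 < s -> ancestor b l s = s' ->
    exists2 i, i <= l & zero (ancestor b i s).
(* Since [s' = t * gcdn s' (b ^ j)], the vertices [j] levels below [t] have index at most
   [t * b ^ j]. *)
have [s' _|L HL] := @uniform_bound Q (t * b ^ j).+1.
  have [|s'0] := posnP s'; first by move=> ->; exists 0 => l _; rewrite /Q.
  have [s't|ns't] := pselect (ancestor b j s' = t); last by exists 0 => l _ _ /ns't.
  have [|L HL] := ih s' s'0; last by exists L => l Ll _ _; exact: HL.
  by apply: jt; apply: (cyclotomic_factorP b j s' t0).2.
exists (j + L) => l jLl s s0 sl; pose s' := ancestor b (l - j) s.
have s's : ancestor b j s' = t by rewrite ancestorD // subnK //; lia.
have s'0 : 0 < s' by exact: ancestor_gt0.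
have [||i il zi] := HL s' (l - j) _ _ s'0 s's s s0 erefl; [|lia|by exists i => //; lia].
rewrite ltnS -s's -{1}(divnK (dvdn_gcdl s' (b ^ j))) leq_mul2l.
by rewrite (dvdn_leq _ (dvdn_gcdr _ _)) ?orbT.
Qed.

Lemma condP_bound k : condP b D k ->
  exists L, forall n e, 0 < e -> e %| b ^ n -> ~~ (e %| b ^ L) ->
    exists2 i, i < n & zero (ancestor b i e).
Proof.
move=> Pk; pose Q d l := d %| b -> 1 < d -> forall s, 0 < s -> ancestor b l s = d ->
    exists2 i, i <= l & zero (ancestor b i s).
have [d _|L HL] := @uniform_bound Q b.+1.
  have [d1|d1] := leqP d 1; first by exists 0 => l _ _; rewrite ltnNge d1.
  have [db|ndb] := boolP (d %| b); last by exists 0 => l _; rewrite /Q (negbTE ndb).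
  have [L HL] := condR_bound (ltnW d1) (Pk d db d1).
  by exists L => l Ll _ _; exact: HL.
exists L.+1 => n e e0 en eL.
have ex : exists k, e %| b ^ k by exists n.
(* The least exponent [l + 1] is the level of [e]; the ancestor [l] levels up is a child of the
   root. *)
case: (ex_minnP ex) => -[|l] el minl.
  by case/negP: eL; apply: dvdn_trans el _; rewrite expn0 dvd1n.
have Ll : L <= l.
  rewrite leqNgt; apply: contraNN eL => lL; apply: dvdn_trans el _.
  by apply: dvdn_exp2l; exact: ltnW.
pose d := ancestor b l e; have d0 : 0 < d by exact: ancestor_gt0.
have db : d %| b by rewrite -(expn1 b) -ancestor_eq1 // ancestorD // addn1 ancestor_eq1.
have d1 : 1 < d.
  rewrite ltn_neqAle d0 andbT eq_sym ancestor_eq1 //; apply/negP => /minl.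
  by rewrite ltnn.
have [|i il zi] := HL d l _ Ll db d1 e e0 erefl.
  by rewrite ltnS dvdn_leq.
by exists i => //; exact: leq_ltn_trans il (minl _ en).
Qed.

End Implications.

(** * Sums of digits and their residues *)

Local Open Scope ring_scope.

Section DigitSums.
Variables (b : nat) (D : {fset nat}).
Hypothesis b_gt1 : (1 < b)%N.

Let b_gt0 : (0 < b)%N. Proof. exact: ltnW. Qed.
Let bX_gt0 k : (0 < b ^ k)%N. Proof. by rewrite expn_gt0 b_gt0. Qed.

Fixpoint digit_sums (n : nat) : seq nat :=
  if n is n'.+1 then [seq (d + b * w)%N | d <- enum_fset D, w <- digit_sums n']
  else [:: 0%N].

Lemma digit_sums_le M n : {in D, forall d, d <= M}%N ->
  {in digit_sums n, forall w, w + M <= M * b ^ n}%N.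
Proof.
move=> DM; elim: n => [w|n ih w]; first by rewrite inE => /eqP ->; rewrite muln1.
move=> /allpairsP[[d v] /= [dD vn ->]]; have := DM _ dD; have := ih _ vn.
rewrite expnS => vM dM; nia.
Qed.

Hypothesis card_D : #|` D|%fset = b.

Lemma size_digit_sums n : size (digit_sums n) = (b ^ n)%N.
Proof. by elim: n => //= n ih; rewrite size_allpairs ih expnS -card_D. Qed.

Lemma big_digit_sumsD (V : nmodType) (F : nat -> V) n k :
  \sum_(w <- digit_sums (n + k)) F w =
  \sum_(u <- digit_sums n) \sum_(v <- digit_sums k) F (u + b ^ n * v)%N.
Proof.
elim: n F => [|n ih] F.
  by rewrite add0n big_seq1; apply: eq_bigr => v _; rewrite mul1n.
rewrite addSn /= !big_allpairs_dep; apply: eq_bigr => d _.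
rewrite ih; apply: eq_bigr => u _; apply: eq_bigr => v _.
by rewrite expnS; congr F; lia.
Qed.

(** The generating polynomial of the digit sums is the product of the [P(x ^ (b ^ k))], so a zero of
    [P] at one of these powers of [z] annihilates the exponential sum. *)
Lemma sum_expr_digit_sums (F : comNzRingType) (z : F) n :
  \sum_(w <- digit_sums n) z ^+ w = \prod_(k < n) (digit_poly F D).[z ^+ (b ^ k)].
Proof.
elim: n z => [|n ih] z; first by rewrite big_seq1 big_ord0.
rewrite /= big_allpairs_dep big_ord_recl expn0 expr1.
transitivity ((digit_poly F D).[z] * \sum_(w <- digit_sums n) (z ^+ b) ^+ w).
  rewrite /digit_poly horner_sum mulr_suml; apply: eq_bigr => d _.
  rewrite hornerXn mulr_sumr; apply: eq_bigr => w _.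
  by rewrite exprD exprM.
by rewrite ih; congr (_ * _); apply: eq_bigr => k _; rewrite -exprM -expnS.
Qed.

Lemma geometric_unity_sum (F : fieldType) (y : F) n :
  y ^+ n = 1 -> y != 1 -> \sum_(j < n) y ^+ j = 0.
Proof.
move=> yn y1; apply/eqP; rewrite -(mulrI_eq0 _ (mulfI (_ : y - 1 != 0))).
  by rewrite -subrX1 yn subrr.
by rewrite subr_eq0.
Qed.

(** Fourier inversion on the integers modulo [n]: after exchanging the sums, each [w] contributes a
    geometric sum equal to [n] or 0. *)
Lemma count_mod_fourier (F : numFieldType) (z : F) n (s : seq nat) x :
  n.-primitive_root z ->
  (n * count (fun w => w == x %[mod n]) s)%:R =
  \sum_(j < n) (\sum_(w <- s) (z ^+ j) ^+ w) * (z ^+ j) ^- x.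
Proof.
move=> zn; have n0 := prim_order_gt0 zn.
have z0 : z != 0 by rewrite (prim_root_eq0 zn) -lt0n.
under eq_bigr do rewrite mulr_suml.
rewrite exchange_big /= -sum1_count natrM natr_sum mulr_sumr big_mkcond /=.
apply: eq_bigr => w _.
transitivity (\sum_(j < n) (z ^+ w / z ^+ x) ^+ j); last first.
  by apply: eq_bigr => j _; rewrite expr_div_n -!exprM ![(_ * j)%N]mulnC.
case: ifPn => [|nwx].
  rewrite -(eq_prim_root_expr zn) => /eqP ->; rewrite divff ?expf_neq0 //.
  by under eq_bigr do rewrite expr1n; rewrite sumr_const card_ord mulr1.
rewrite geometric_unity_sum //.
  by rewrite expr_div_n -!exprM ![(_ * n)%N]mulnC !exprM (prim_expr_order zn) !expr1n divr1.
apply: contraNneq nwx => wx; rewrite -(eq_prim_root_expr zn).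
by rewrite -[X in X == _](divfK (expf_neq0 x z0)) wx mul1r.
Qed.

(** A frequency [y] with [y ^+ (b ^ L) != 1] has a zero of [P] among the [y ^+ (b ^ i)], [i < n], so
    the residue counts are invariant under translation by [b ^ L]; from one attained residue [x],
    all its translates are attained. *)
Lemma digit_sums_mod_cover k : condP b D k ->
  exists L, forall n, exists x, forall t, exists2 w, w \in digit_sums n &
    (w = x + t * b ^ L %[mod b ^ n])%N.
Proof.
move=> /(condP_bound b_gt1 card_D)[L HL]; exists L => n.
have [z zn] := C_prim_root_exists (bX_gt0 n).
have per x : count (fun w => w == x %[mod b ^ n])%N (digit_sums n) =
    count (fun w => w == (x + b ^ L)%N %[mod b ^ n])%N (digit_sums n).
  apply/eqP; rewrite -(eqn_pmul2l (bX_gt0 n)) -(eqr_nat algC).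
  rewrite !(count_mod_fourier _ _ zn); apply/eqP; apply: eq_bigr => j _.
  have z0 : z != 0 by rewrite (prim_root_eq0 zn) -lt0n.
  set y := z ^+ j; have [y1|y1] := eqVneq (y ^+ (b ^ L)) 1.
    by rewrite exprD y1 mulr1.
  rewrite (_ : \sum_(w <- _) _ = 0) ?mul0r // sum_expr_digit_sums.
  have ye := exp_prim_root zn j; rewrite -/y in ye.
  have [||i ilt zi] := HL n _ (prim_order_gt0 ye) _ _.
  - by rewrite dvdn_div ?dvdn_gcdr.
  - by rewrite (prim_order_dvd ye).
  apply/eqP/prodf_eq0; exists (Ordinal ilt) => //=.
  by move: zi; rewrite (Cyclotomic_dvdp _ (prim_root_ancestor b i ye)) digit_poly_map.
have [x xin] : exists x, x \in digit_sums n.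
  have := size_digit_sums n; case: (digit_sums n) => [|x s] e.
    by have := bX_gt0 n; rewrite -e.
  by exists x; exact: mem_head.
exists x => t.
suff : (0 < count (fun w => w == x + t * b ^ L %[mod b ^ n]) (digit_sums n))%N.
  by rewrite -has_count => /hasP[w ws /eqP]; exists w.
elim: t => [|t ih]; last by rewrite mulSnr addnA -per.
by rewrite mul0n addn0 -has_count; apply/hasP; exists x.
Qed.

(** * Second moments of the residue counts *)

Definition residue_count (n x : nat) : nat :=
  count (fun w => w %% b ^ n == x)%N (digit_sums n).

(* b ^ n times the second moment of residue_count n, a martingale in n for
   the uniform measure on residues (sum_residue_count_mod). *)
Definition energy (n : nat) : nat := \sum_(x < b ^ n) residue_count n x ^ 2.

Lemma sum_residues (V : nmodType) (G : nat -> V) n (s : seq nat) : (0 < n)%N ->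
  \sum_(w <- s) G (w %% n)%N = \sum_(x < n) G x *+ count (fun w => w %% n == x)%N s.
Proof.
move=> n0; under [RHS]eq_bigr do rewrite -sum1_count -sumrMnr big_mkcond.
rewrite exchange_big /=; apply: eq_bigr => w _.
rewrite (bigD1 (Ordinal (ltn_pmod w n0))) //= eqxx mulr1n big1 ?addr0 // => x xw.
case: eqP => // e; case/eqP: xw; exact/val_inj.
Qed.

Lemma sum_mul_ord (V : nmodType) (F : nat -> V) m n :
  \sum_(x < m * n) F x = \sum_(v < n) \sum_(u < m) F (u + m * v)%N.
Proof.
elim: n => [|n ih]; first by rewrite muln0 !big_ord0.
rewrite big_ord_recr /= -ih mulnSr.
by rewrite big_split_ord /=; congr (_ + _); apply: eq_bigr => u _; rewrite addnC.
Qed.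

(** Martingale property, tested against a function of the residue mod [b ^ n]: a sum of length
    [n + s] is [u + b ^ n * v], with [b ^ s] choices of [v] for each [u]. *)
Lemma sum_residue_count_mod (V : nmodType) (G : nat -> V) n s :
  \sum_(x < b ^ (n + s)) G (x %% b ^ n)%N *+ residue_count (n + s) x =
  (\sum_(x < b ^ n) G x *+ residue_count n x) *+ (b ^ s).
Proof.
rewrite -(sum_residues (fun x => G (x %% b ^ n)%N)) // -sum_residues //.
transitivity (\sum_(w <- digit_sums (n + s)) G (w %% b ^ n)%N).
  by apply: eq_bigr => w _; rewrite modn_dvdm // dvdn_exp2l // leq_addr.
rewrite big_digit_sumsD -sumrMnl; apply: eq_bigr => u _.
rewrite -(size_digit_sums s) -iter_addr_0 -(count_predT (digit_sums s)) -big_const_seq.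
by apply: eq_bigr => v _; rewrite addnC mulnC modnMDl.
Qed.

(* Orthogonality of martingale increments. *)
Lemma energy_defect n s :
  \sum_(x < b ^ (n + s)) ((residue_count (n + s) x)%:Z - (residue_count n (x %% b ^ n))%:Z) ^+ 2
  = (energy (n + s))%:Z - (b ^ s * energy n)%:Z.
Proof.
have cross : \sum_(x < b ^ (n + s))
    (residue_count (n + s) x)%:Z * (residue_count n (x %% b ^ n))%:Z = (b ^ s * energy n)%:Z.
  transitivity (\sum_(x < b ^ (n + s))
      (residue_count n (x %% b ^ n))%:Z *+ (residue_count (n + s) x)).
    by apply: eq_bigr => x _; rewrite -mulr_natl natz.
  rewrite (sum_residue_count_mod (fun x => (residue_count n x)%:Z)).
  rewrite -[RHS]natz mulnC mulrnA natr_sum; congr (_ *+ _).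
  by apply: eq_bigr => x _; rewrite -[X in X *+ _]natz -mulrnA mulnn.
have sq : \sum_(x < b ^ (n + s)) (residue_count n (x %% b ^ n))%:Z ^+ 2 = (b ^ s * energy n)%:Z.
  rewrite expnD (sum_mul_ord (fun x => (residue_count n (x %% b ^ n))%:Z ^+ 2)).
  rewrite (eq_bigr (fun=> (energy n)%:Z)) => [|v _].
    by rewrite sumr_const card_ord -[X in X *+ _]natz -mulrnA natz mulnC.
  rewrite -[RHS]natz natr_sum; apply: eq_bigr => u _.
  by rewrite addnC mulnC modnMDl modn_small // natrX natz.
transitivity (\sum_(x < b ^ (n + s)) (residue_count (n + s) x)%:Z ^+ 2
   + \sum_(x < b ^ (n + s)) (residue_count n (x %% b ^ n))%:Z ^+ 2
   - (\sum_(x < b ^ (n + s))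
        (residue_count (n + s) x)%:Z * (residue_count n (x %% b ^ n))%:Z) *+ 2).
  by rewrite -sumrMnl -sumrN -!big_split /=; apply: eq_bigr => x _; ring.
rewrite cross sq -[(energy (n + s))%:Z]natz natr_sum.
under [X in _ = X - _]eq_bigr do rewrite natrX natz.
ring.
Qed.

Lemma energy_mono n s : (b ^ s * energy n <= energy (n + s))%N.
Proof.
have : 0 <= (energy (n + s))%:Z - (b ^ s * energy n)%:Z.
  by rewrite -energy_defect sumr_ge0 // => x _; exact: sqr_ge0.
by rewrite subr_ge0 lez_nat.
Qed.

(** The sum is a Fourier coefficient of the count at level [n + s]. The count at level [n] has none
    at this frequency and may be subtracted; the increments are integers, bounded in absolute value
    by their squares. *)
Lemma norm_sum_digit_sums_le (F : numFieldType) (z : F) n s :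
  z ^+ (b ^ (n + s)) = 1 -> z ^+ (b ^ n) != 1 ->
  `|\sum_(w <- digit_sums (n + s)) z ^+ w| <= (energy (n + s) - b ^ s * energy n)%:R.
Proof.
move=> zN zn; set N := (b ^ (n + s))%N.
have -> : \sum_(w <- digit_sums (n + s)) z ^+ w =
    \sum_(x < N) ((residue_count (n + s) x)%:Z - (residue_count n (x %% b ^ n))%:Z)%:~R * z ^+ x.
  transitivity (\sum_(x < N) z ^+ x *+ residue_count (n + s) x).
    rewrite -(sum_residues (fun x => z ^+ x)) ?bX_gt0 //; apply: eq_bigr => w _.
    by rewrite {1}(divn_eq w N) exprD mulnC exprM zN expr1n mul1r.
  under [RHS]eq_bigr do rewrite rmorphB mulrBl /=.
  rewrite sumrB [X in _ - X](_ : _ = 0) ?subr0; last first.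
    rewrite /N expnD.
    rewrite (sum_mul_ord (fun x => (residue_count n (x %% b ^ n))%:~R * z ^+ x)) exchange_big /= big1 // => u _.
    transitivity ((residue_count n u)%:~R * z ^+ u * \sum_(v < b ^ s) (z ^+ (b ^ n)) ^+ v).
      rewrite mulr_sumr; apply: eq_bigr => v _.
      by rewrite addnC mulnC modnMDl modn_small // exprD -exprM mulnC -mulrA [_ * z ^+ u]mulrC.
    by rewrite geometric_unity_sum ?mulr0 // -exprM -expnD.
  by apply: eq_bigr => x _; rewrite -mulr_natl.
have z1 : `|z| = 1.
  apply/eqP; rewrite -(@pexpr_eq1 _ _ N) ?bX_gt0 //.
  by rewrite -normrX zN normr1.
apply: le_trans (ler_norm_sum _ _ _) _.
have -> : (energy (n + s) - b ^ s * energy n)%:R = ((energy (n + s))%:Z - (b ^ s * energy n)%:Z)%:~R :> F.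
  by rewrite rmorphB /= natrB // energy_mono.
rewrite -energy_defect rmorph_sum /=; apply: ler_sum => x _.
(* |y| <= y^2 for an integer y *)
rewrite normrM normrX z1 expr1n mulr1 -intr_norm ler_int.
set y := (_ - _ : int); have [->|y0] := eqVneq y 0; first by rewrite normr0 expr0n.
by rewrite -[leRHS]ger0_norm ?sqr_ge0 // normrX expr2 ler_peMr // -gtz0_ge1 normr_gt0.
Qed.

(** Distinct sums with equal residue have distinct quotients by [b ^ n], all at most [M]; so each
    count is at most [M + 1], and the counts add up to [b ^ n]. *)
Lemma energy_le M n : {in D, forall d, d <= M}%N -> uniq (digit_sums n) ->
  (energy n <= M.+1 * b ^ n)%N.
Proof.
move=> DM un.
have rM x : (residue_count n x <= M.+1)%N.
  rewrite /residue_count -size_filter -(size_map (fun w => w %/ b ^ n)%N).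
  rewrite -[leqRHS](size_iota 0); apply: uniq_leq_size.
    rewrite map_inj_in_uniq ?filter_uniq // => u v.
    rewrite !mem_filter => /andP[/eqP ux _] /andP[/eqP vx _] uv.
    by rewrite (divn_eq u (b ^ n)) (divn_eq v (b ^ n)) ux vx uv.
  move=> y /mapP[w]; rewrite mem_filter => /andP[_ wn] ->.
  rewrite mem_iota add0n ltn_divLR //; have := digit_sums_le DM wn.
  by have := bX_gt0 n; nia.
apply: (@leq_trans (\sum_(x < b ^ n) residue_count n x * M.+1)%N).
  by apply: leq_sum => x _; rewrite expnS expn1 leq_mul2l rM orbT.
rewrite -big_distrl /= mulnC leq_mul2l /=.
have := sum_residues (fun=> 1%N) (digit_sums n) (bX_gt0 n).
rewrite sum1_size size_digit_sums => e; rewrite [leqRHS]e; apply: leq_sum => x _.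
have e1 c : 1%N *+ c = c :> nat by elim: c => // c ih; rewrite mulrS ih.
by rewrite e1.
Qed.

End DigitSums.

(** * The self-affine set *)

Local Open Scope classical_set_scope.
Local Open Scope ring_scope.

Lemma uniform_radius (R : realFieldType) (I : eqType) (s : seq I) (Q : I -> R -> Prop) :
  (forall i, i \in s -> exists2 e, 0 < e & forall d, d <= e -> Q i d) ->
  exists2 e, 0 < e & forall i, i \in s -> Q i e.
Proof.
move=> H; suff [e e0 He] : exists2 e, 0 < e & forall i d, i \in s -> d <= e -> Q i d.
  by exists e => // i /He; apply.
elim: s H => [|i s ih] H; first by exists 1.
have [j js|e e0 He] := ih; first by apply: H; rewrite inE js orbT.
have [e' e'0 He'] := H i (mem_head _ _).
exists (Num.min e e'); first by rewrite lt_min e0.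
move=> j d; rewrite inE le_min => /orP[/eqP ->|js] /andP[de de']; first exact: He'.
exact: He.
Qed.

Section SelfAffine.
Variables (R : realType) (b : nat) (D : {fset nat}).
Hypothesis b_gt1 : (1 < b)%N.

Let b_gt0 : (0 < b)%N. Proof. exact: ltnW. Qed.
Let bR_gt0 : 0 < b%:R :> R. Proof. by rewrite ltr0n. Qed.
Let bR_neq0 : b%:R != 0 :> R. Proof. exact: lt0r_neq0. Qed.
Let bX_gt0 n : 0 < b%:R ^+ n :> R. Proof. exact: exprn_gt0. Qed.
Let bX_neq0 n : b%:R ^+ n != 0 :> R. Proof. exact: lt0r_neq0. Qed.

Notation T := (@self_affine_set R b D).

Lemma expr_unbounded (x : R) : exists N, forall n, (N <= n)%N -> x < b%:R ^+ n.
Proof.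
exists (Num.bound x) => n /upper_nthrootP H; apply: lt_le_trans H _.
by apply: lerXn2r; rewrite ?nnegrE // ler_nat.
Qed.

Lemma div_expr_small (x e : R) : 0 < e -> exists N, forall n, (N <= n)%N -> x / b%:R ^+ n < e.
Proof.
move=> e0; have [N H] := expr_unbounded (x / e); exists N => n /H.
by rewrite ltr_pdivrMr // ltr_pdivrMr // mulrC.
Qed.

Lemma digits_bounded : exists M, {in D, forall d, (d <= M)%N}.
Proof.
exists (\max_(d <- D) d)%N => d dD; rewrite (big_rem _ dD) /=.
exact: leq_maxl.
Qed.

(** A coinduction principle: the chosen digits define an orbit of [s] in the bounded set [S], and
    the remainder [y n / b ^ n] tends to 0. *)
Lemma sub_self_affine (S : set R) (C : R) :
  (forall s, S s -> `|s| <= C) ->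
  (forall s, S s -> exists2 d, d \in D & S (b%:R * s - d%:R)) -> S `<=` T.
Proof.
move=> SC Sstep s Ss.
have /choice[f fP] : forall y, exists d, S y -> d \in D /\ S (b%:R * y - d%:R).
  move=> y; have [/Sstep[d dD Sd]|nS] := pselect (S y); first by exists d.
  by exists 0%N.
pose y n := iter n (fun y => b%:R * y - (f y)%:R) s.
have Sy n : S (y n) by elim: n => //= n /fP[].
exists (fun k => f (y k.-1)).
  by case=> // k _; have [] := fP _ (Sy k).
have eqy n : \sum_(1 <= k < n.+1) (f (y k.-1))%:R / b%:R ^+ k = s - y n / b%:R ^+ n.
  elim: n => [|n ih]; first by rewrite big_nil expr0 divr1 subrr.
  rewrite big_nat_recr //= ih exprS; field.
  by rewrite bR_neq0 bX_neq0.
under eq_fun do rewrite eqy.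
apply/cvgrPdist_le => /= e e0; have [N HN] := div_expr_small C e0.
exists N => // n /= Nn; rewrite opprB addrCA subrr addr0 normrM normfV (gtr0_norm (bX_gt0 n)).
apply: le_trans (ltW (HN n Nn)).
by rewrite ler_pM2r ?invr_gt0 // SC.
Qed.

Lemma self_affine_bounds M x : {in D, forall d, (d <= M)%N} -> T x -> 0 <= x <= M%:R.
Proof.
move=> DM [d dD dx]; apply/andP; split.
  apply: (ler_cvg_to (cvg_cst 0) dx); near=> n.
  by rewrite sumr_ge0 // => k _; rewrite divr_ge0 ?ler0n // ltW.
have bd n : \sum_(1 <= k < n.+1) (d k)%:R / b%:R ^+ k <= M%:R - M%:R / b%:R ^+ n :> R.
  elim: n => [|n ih]; first by rewrite big_nil expr0 divr1 subrr.
  rewrite big_nat_recr //= (le_trans (lerD ih (lexx _))) // -lerBrDl.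
  have -> : M%:R - M%:R / b%:R ^+ n.+1 - (M%:R - M%:R / b%:R ^+ n) =
      (M%:R * b%:R - M%:R) / b%:R ^+ n.+1 :> R.
    by rewrite exprS; field; rewrite bR_neq0 bX_neq0.
  rewrite ler_pM2r ?invr_gt0 // lerBrDr -natrD -natrM ler_nat.
  have := DM (d n.+1) (dD n.+1 isT); nia.
apply: (ler_cvg_to dx (cvg_cst (M%:R : R))); near=> n.
by rewrite (le_trans (bd n)) // gerBl divr_ge0 ?ler0n // ltW.
Unshelve. all: by end_near.
Qed.

Lemma self_affine_unfold x : T x -> exists2 d, d \in D & T (b%:R * x - d%:R).
Proof.
move=> [d dD dx]; exists (d 1%N); first exact: dD.
exists (fun k => d k.+1) => [k _|]; first exact: dD.
have -> : (fun n => \sum_(1 <= k < n.+1) (d k.+1)%:R / b%:R ^+ k) =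
    (fun n => b%:R * (\sum_(1 <= k < n.+2) (d k)%:R / b%:R ^+ k) - (d 1%N)%:R :> R).
  apply/funext => n; rewrite [in RHS]big_nat_recl // expr1 mulrDr mulrC divfK // addrC addKr.
  rewrite mulr_sumr; apply: eq_bigr => k _; rewrite exprS; field.
  by rewrite bR_neq0 bX_neq0.
apply: cvgB; last exact: cvg_cst.
by apply: cvgMl_tmp; move: dx; rewrite -cvg_shiftS.
Qed.

Lemma self_affine_fold d x : d \in D -> T x -> T ((d%:R + x) / b%:R).
Proof.
move=> dD Tx; have [M DM] := digits_bounded.
apply: (@sub_self_affine [set y | T y \/ y = (d%:R + x) / b%:R] M%:R); last by right.
  move=> y [/(self_affine_bounds DM)/andP[y0 yM]|->]; first by rewrite ger0_norm.
  have /andP[x0 xM] := self_affine_bounds DM Tx.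
  rewrite ger0_norm ?divr_ge0 ?addr_ge0 ?ler0n // ler_pdivrMr //.
  have : d%:R <= M%:R :> R by rewrite ler_nat DM.
  have : 2 <= b%:R :> R by rewrite (ler_nat _ 2).
  have : 0 <= M%:R :> R by [].
  move: (b%:R : R) (M%:R : R) (d%:R : R) xM => B m d' xM m0 B2 dm; nra.
move=> y [/self_affine_unfold[d' d'D Td']|->]; first by exists d' => //; left.
by exists d => //; left; rewrite mulrC divfK // addrC addKr.
Qed.

(** The closure of [T] is stable under expansion: if every [b * y - d] stayed away from [T], one gap
    [e] would serve all digits, against a point of [T] within [e / b] of [y]. *)
Lemma self_affine_closed x :
  (forall e, 0 < e -> exists2 t, T t & `|x - t| < e) -> T x.
Proof.
have [M DM] := digits_bounded.
apply: (@sub_self_affine [set x | forall e, 0 < e -> exists2 t, T t & `|x - t| < e] (M%:R + 1)).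
  move=> y /(_ 1 ltr01)[t /(self_affine_bounds DM)/andP[t0 tM] yt].
  have -> : y = (y - t) + t by rewrite subrK.
  apply: le_trans (ler_normD _ _) _; rewrite addrC; apply: lerD; last exact: ltW.
  by rewrite ger0_norm.
move=> y Sy; apply: contrapT => /forall2NP nD.
have [d dD|e e0 He] := @uniform_radius R nat D
    (fun d e => forall t, T t -> e <= `|b%:R * y - d%:R - t|).
  have [//|/existsNP[e /not_implyP[e0 /forall2NP nt]]] := nD d.
  exists e => // e' e'e t Tt; rewrite (le_trans e'e) // leNgt; apply/negP => lt.
  by have [] := nt t.
have [t Tt yt] := Sy (e / b%:R) (divr_gt0 e0 bR_gt0).
have [d dD Td] := self_affine_unfold Tt.
have := He d dD _ Td; rewrite leNgt => /negP; apply.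
have -> : b%:R * y - d%:R - (b%:R * t - d%:R) = b%:R * (y - t) by ring.
by rewrite normrM gtr0_norm // mulrC -ltr_pdivlMr.
Qed.

Lemma self_affine_expand n x : T x ->
  exists2 w, w \in digit_sums b D n & T (b%:R ^+ n * x - w%:R).
Proof.
move=> Tx; elim: n => [|n [w wn Tw]].
  by exists 0%N; rewrite ?inE // expr0 mul1r subr0.
have [d dD Td] := self_affine_unfold Tw.
exists (d + b * w)%N; first by apply/allpairsP; exists (d, w).
move: Td; congr T; rewrite natrD natrM exprS; ring.
Qed.

Lemma self_affine_contract n w x : w \in digit_sums b D n -> T x ->
  T ((w%:R + x) / b%:R ^+ n).
Proof.
elim: n w x => [|n ih] w x; first by rewrite inE => /eqP -> Tx; rewrite add0r expr0 divr1.
move=> /allpairsP[[d v] /= [dD vn ->]] Tx.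
have := ih _ _ vn (self_affine_fold dD Tx); congr T.
rewrite natrD natrM exprS; field; by rewrite bR_neq0 bX_neq0.
Qed.

Hypothesis card_D : #|` D|%fset = b.

Lemma digits_neq0 : exists d, d \in D.
Proof.
have : D != fset0 by rewrite -cardfs_gt0 card_D.
by move=> /fset0Pn.
Qed.

Lemma self_affine_neq0 : T !=set0.
Proof.
have [d dD] := digits_neq0.
(* The point all of whose digits are [d], fixed by expansion. *)
exists (d%:R / (b%:R - 1)).
apply: (@sub_self_affine [set d%:R / (b%:R - 1)] `|d%:R / (b%:R - 1)|) => // _ -> //.
exists d => //=; have b1 : b%:R - 1 != 0 :> R by rewrite subr_eq0 pnatr_eq1 gtn_eqF.
by field.
Qed.

End SelfAffine.

(** Used with [A = b ^ L] and [B = b ^ n]. Some [v] congruent to [x] mod [A] lies near [y * B]; [t]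
    makes [x + t * A] congruent to [v] mod [B], so that [v = w + z * B] and [w / B] is near
    [y - z]. *)
Lemma residue_approx (R : realType) (y : R) (M A B x : nat) :
  (0 < A)%N -> (0 < B)%N -> (M + 2 + A)%:R <= y ->
  exists t, forall w, (w + M <= M * B)%N -> (w = x + t * A %[mod B])%N ->
    exists2 z, (z <= Num.trunc y + A)%N & `|y * B%:R - (w + z * B)%:R| <= (A + 1)%:R.
Proof.
move=> A0 B0 yY; have y0 : 0 <= y by apply: le_trans yY; rewrite ler0n.
have [Y /andP[Y1 Y2]] : exists Y, Y%:R <= y * B%:R < Y.+1%:R.
  by exists (Num.trunc (y * B%:R)); apply: truncn_itv; rewrite mulr_ge0.
(* Modulo [B], the multiplier [B.-1] acts as -1 and reduces [x] to its remainder modulo [A]. *)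
have [v [vY Yv vx]] : exists v, [/\ (v <= Y + A)%N, (Y <= v + A)%N
    & (x + (Y %/ A + B.-1 * (x %/ A)) * A = v %[mod B])%N].
  exists (x %% A + Y %/ A * A)%N.
  have := leq_divM Y A; have := ltn_ceil Y A0; have := ltn_pmod x A0; rewrite mulSnr.
  move=> rA Yp pY; split; [move: rA pY|move: Yp|]; [clear; lia|clear; lia|].
  rewrite [X in (X + _ * A)%N](divn_eq x A) -(prednK B0) /=.
  move: (x %/ A)%N (x %% A)%N (Y %/ A)%N (B.-1) => q r p B'.
  have -> : (q * A + r + (p + B' * q) * A = q * A * B'.+1 + (r + p * A))%N by clear; lia.
  by rewrite modnMDl.
exists (Y %/ A + B.-1 * (x %/ A))%N => w wM; rewrite vx => wv.
have MY : (M * B + A <= Y)%N.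
  rewrite -ltnS -(ltr_nat R); apply: le_lt_trans Y2.
  apply: (@le_trans _ _ ((M + 2 + A)%:R * B%:R)); last by rewrite ler_pM2r ?ltr0n.
  by rewrite -natrM ler_nat !mulnDl leq_add ?leq_addr // leq_pmulr.
have wv' : (w <= v)%N by move: wM MY Yv; clear; lia.
have [z vz] : exists z, (v = w + z * B)%N.
  exists ((v - w) %/ B)%N; rewrite divnK ?subnKC //.
  by rewrite -eqn_mod_dvd // wv.
exists z.
  have Yy : (Y < (Num.trunc y).+1 * B)%N.
    rewrite -(ltr_nat R) (le_lt_trans Y1) // natrM ltr_pM2r ?ltr0n //.
    by have /andP[] := truncn_itv y0.
  rewrite -ltnS -(ltn_pmul2r B0); move: (Num.trunc y) Yy vY vz B0; clear => p; nia.
have : v%:R <= Y%:R + A%:R :> R by rewrite -natrD ler_nat.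
have : Y%:R <= v%:R + A%:R :> R by rewrite -natrD ler_nat.
rewrite -vz natrD ler_norml; move: Y1 Y2; rewrite -natr1.
move: (y * B%:R) (Y%:R : R) (v%:R : R) (A%:R : R); clear => u Y' v' A' u1 u2 v1 v2.
by apply/andP; split; lra.
Qed.

(** * Interior points: counting digit sums and Baire category *)

Section Interior.
Variables (R : realType) (b : nat) (D : {fset nat}).
Hypothesis b_gt1 : (1 < b)%N.
Hypothesis card_D : #|` D|%fset = b.

Let b_gt0 : (0 < b)%N. Proof. exact: ltnW. Qed.
Let bR_gt0 : 0 < b%:R :> R. Proof. by rewrite ltr0n. Qed.
Let bX_gt0 n : 0 < b%:R ^+ n :> R. Proof. exact: exprn_gt0. Qed.
Let bX_neq0 n : b%:R ^+ n != 0 :> R. Proof. exact: lt0r_neq0. Qed.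

Notation T := (@self_affine_set R b D).

Lemma mem_digit_sumsD n k w : w \in digit_sums b D (n + k) ->
  exists u v, [/\ u \in digit_sums b D n, v \in digit_sums b D k & w = u + b ^ n * v]%N.
Proof.
elim: n w => [|n ih] w; first by exists 0%N, w; rewrite mul1n add0n inE.
move=> /allpairsP[[d x] /= [dD xn ->]]; have [u [v [un vk ->]]] := ih _ xn.
exists (d + b * u)%N, v; split=> //; first by apply/allpairsP; exists (d, u).
rewrite expnS; lia.
Qed.

(** Submultiplicativity: a single collision lowers the exponential growth rate of the number of
    distinct sums. *)
Lemma size_undup_digit_sumsM n j :
  (size (undup (digit_sums b D (n * j))) <= size (undup (digit_sums b D n)) ^ j)%N.
Proof.
elim: j => [|j ih]; first by rewrite muln0.
rewrite expnS; apply: (@leq_trans (size [seq (u + b ^ n * v)%N | u <- undup (digit_sums b D n),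
    v <- undup (digit_sums b D (n * j))])); last by rewrite size_allpairs leq_mul2l ih orbT.
apply: uniq_leq_size; first exact: undup_uniq.
move=> w; rewrite mem_undup mulnS => /mem_digit_sumsD[u [v [un vj ->]]].
by apply/allpairsP; exists (u, v); rewrite !mem_undup.
Qed.

(** The interval contains about [e * b ^ n] points [y / b ^ n]; expanding one gives [y = w + j] with
    [w] a digit sum and [0 <= j <= M]. *)
Lemma size_undup_digit_sums_ge M x e n : {in D, forall d, (d <= M)%N} ->
  0 <= x -> 0 < e -> (forall y, x < y < x + e -> T y) ->
  e * b%:R ^+ n <= 2 + (M.+1 * size (undup (digit_sums b D n)))%:R.
Proof.
move=> DM x0 e0 eT; set B : R := b%:R ^+ n; have B0 : 0 < B by exact: bX_gt0.
have [X /andP[X1 X2]] : exists X, X%:R <= x * B < X.+1%:R.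
  by exists (Num.trunc (x * B)); apply: truncn_itv; rewrite mulr_ge0 // ltW.
have [K /andP[K1 K2]] : exists K, K%:R <= e * B < K.+1%:R.
  by exists (Num.trunc (e * B)); apply: truncn_itv; rewrite mulr_ge0 // ltW.
suff : (K.-1 <= M.+1 * size (undup (digit_sums b D n)))%N.
  move=> H; apply: le_trans (ltW K2) _; rewrite -natrD ler_nat; lia.
rewrite -[leqLHS](size_iota X.+1) -(size_iota 0 M.+1).
rewrite -(size_allpairs (fun j w => (j + w)%N)).
apply: (@uniq_leq_size _ _ [seq (j + w)%N | j <- iota 0 M.+1, w <- undup (digit_sums b D n)]).
  exact: iota_uniq.
move=> y; rewrite mem_iota => /andP[Xy yK].
have Ty : T (y%:R / B).
  apply: eT; rewrite ltr_pdivlMr // ltr_pdivrMr // mulrDl.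
  rewrite (lt_le_trans X2) ?ler_nat //=.
  apply: (@lt_le_trans _ _ (X%:R + K%:R)); last exact: lerD.
  by rewrite -natrD ltr_nat; lia.
have [w wn Tw] := self_affine_expand b_gt1 n Ty.
have /andP[] := self_affine_bounds b_gt1 DM Tw.
rewrite mulrC divfK ?bX_neq0 // subr_ge0 lerBlDr -natrD !ler_nat => wy yw.
apply/allpairsP; exists ((y - w)%N, w).
rewrite mem_iota mem_undup wn; split=> //=; move: wy yw; clear; lia.
Qed.

(** Bernoulli's inequality for [(1 + 1 / q) ^ j], with denominators cleared. *)
Lemma exp_succ_ge q j : (q ^ j * (q + j) <= q.+1 ^ j * q)%N.
Proof.
elim: j => [|j ih]; first by rewrite addn0.
rewrite !expnS; move: (q ^ j)%N (q.+1 ^ j)%N ih => u v ih; nia.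
Qed.

(** A collision at length [n] leaves at most [q ^ j] distinct sums of length [n * j], with
    [q = b ^ n - 1]; an interval in [T] requires a fixed proportion of [(q + 1) ^ j], impossible for
    large [j]. *)
Lemma uniq_digit_sums n : T° !=set0 -> uniq (digit_sums b D n).
Proof.
move=> [x xT]; apply: contraT => nu; exfalso.
have [M DM] := digits_bounded D.
have /nbhs_ballP[e /= e0 eT] := xT.
have /andP[x0 _] := self_affine_bounds b_gt1 DM (interior_subset xT).
have {}eT y : x < y < x + e -> T y.
  move=> /andP[xy ye]; apply: eT; rewrite /ball /= distrC gtr0_norm ?subr_gt0 //.
  by rewrite ltrBlDl.
have lt : (size (undup (digit_sums b D n)) < b ^ n)%N.
  by rewrite -(size_digit_sums card_D) ltn_size_undup.
pose q := (b ^ n).-1; have qE : q.+1 = (b ^ n)%N by rewrite prednK // expn_gt0 b_gt0.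
have q0 : (0 < q)%N.
  rewrite -ltnS qE; apply: leq_trans lt; rewrite !ltnS.
  have := size_digit_sums card_D n; case: (digit_sums b D n) => [|y s]; last first.
    by move=> _; have := mem_head y s; rewrite -mem_undup; case: (undup _).
  by move=> /= e1; have := qE; rewrite -e1.
have main j : e * (q + j)%:R <= (M.+3 * q)%:R.
  have := size_undup_digit_sums_ge (n * j) DM x0 e0 eT.
  have le1 : (size (undup (digit_sums b D (n * j))) <= q ^ j)%N.
    apply: leq_trans (size_undup_digit_sumsM _ _) _.
    case: j => // j; by rewrite leq_exp2r // -ltnS qE.
  have Q0 : (0 < q ^ j)%N by rewrite expn_gt0 q0.
  rewrite exprM -natrX -qE -natrX => H.
  rewrite -(ler_pM2l (_ : 0 < (q ^ j)%:R)) ?ltr0n // mulrCA -natrM.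
  apply: (@le_trans _ _ (e * (q.+1 ^ j * q)%:R)).
    by rewrite ler_pM2l // ler_nat exp_succ_ge.
  rewrite natrM mulrA.
  apply: (@le_trans _ _ ((2 + (M.+1 * q ^ j))%:R * q%:R)).
    rewrite ler_pM2r ?ltr0n //; apply: le_trans H _.
    by rewrite -natrD ler_nat; nia.
  by rewrite -!natrM ler_nat; nia.
pose j := Num.bound ((M.+3 * q)%:R / e).
have := main j; apply/negP; rewrite -ltNge.
have : (M.+3 * q)%:R / e < j%:R by apply: archi_boundP; rewrite divr_ge0 // ltW.
rewrite ltr_pdivrMr // mulrC => /lt_le_trans; apply.
by rewrite ler_pM2l // ler_nat leq_addl.
Qed.

Lemma interior_of_condP k : condP b D k -> T° !=set0.
Proof.
move=> /(digit_sums_mod_cover b_gt1 card_D)[L HL].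
have [M DM] := digits_bounded D.
have [t0 Tt0] := self_affine_neq0 R b_gt1 card_D.
have /andP[t00 t0M] := self_affine_bounds b_gt1 DM Tt0.
pose Y0 : R := (M + 2 + b ^ L)%:R.
have bn_gt0 n : (0 < b ^ n)%N by rewrite expn_gt0 b_gt0.
have approx y n : Y0 <= y -> exists z t, [/\ (z <= Num.trunc y + b ^ L)%N, T t &
    `|y - z%:R - t| <= (b ^ L + 1 + M)%:R / b%:R ^+ n].
  move=> yY; have [x Hx] := HL n.
  have [t Ht] := residue_approx x (bn_gt0 L) (bn_gt0 n) yY.
  have [w wn wt] := Hx t.
  have [z zy yz] := Ht w (digit_sums_le b_gt1 DM wn) wt.
  exists z, ((w%:R + t0) / b%:R ^+ n); split=> //; first exact: self_affine_contract.
  have -> : y - z%:R - (w%:R + t0) / b%:R ^+ n =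
      (y * (b ^ n)%:R - (w + z * b ^ n)%:R - t0) / b%:R ^+ n.
    by rewrite natrD natrM natrX; field.
  rewrite normrM normfV (gtr0_norm (bX_gt0 n)) ler_pM2r ?invr_gt0 //.
  apply: le_trans (ler_normB _ _) _; rewrite [leRHS]natrD; apply: lerD => //.
  by rewrite ger0_norm.
(* The range of [z] does not depend on [n], so it is finite; if [y] lay in no translate, closedness
   would give a common positive distance to all of these. *)
have cover y : Y0 <= y -> exists z : nat, T (y - z%:R).
  move=> yY; apply: contrapT => /forallNP nz.
  have [z _|e e0 He] := @uniform_radius R nat (iota 0 (Num.trunc y + b ^ L).+1)
      (fun z e => forall t, T t -> e <= `|y - z%:R - t|).
    apply: contrapT => /forall2NP H; apply: (nz z); apply: (self_affine_closed b_gt1).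
    move=> e e0; have [//|/existsNP[d /not_implyP[de /existsNP[t /not_implyP[Tt]]]]] := H e.
    by move=> /negP; rewrite -ltNge => lt; exists t => //; exact: lt_le_trans lt de.
  have [N HN] := div_expr_small b_gt1 (b ^ L + 1 + M)%:R e0.
  have [z [t [zy Tt yzt]]] := approx y N yY.
  have := He z _ t Tt; rewrite mem_iota /= add0n ltnS zy => /(_ isT).
  by apply/negP; rewrite -ltNge; apply: le_lt_trans yzt (HN N (leqnn _)).
apply: contrapT => /nonemptyPn noint.
(* Without interior, the complements of the translates of [T] are open and dense, so by Baire's
   theorem some [y > Y0] lies in no translate. *)
pose F (z : nat) : set R^o := [set y | ~ T (y - z%:R)].
have FP z : open (F z) /\ dense (F z).
  split.
    rewrite openE => y Fy; apply/nbhs_ballP; apply: contrapT => /forall2NP H.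
    apply: Fy; apply: (self_affine_closed b_gt1) => e e0; have [//|] := H e.
    move=> /existsNP[u /not_implyP[yu /contrapT Tu]]; exists (u - z%:R) => //.
    by rewrite opprB addrA subrK.
  move=> U [p Up] Uopen; apply: contrapT => /nonemptyPn UF.
  have : (T°) (p - z%:R).
    have : nbhs p U by exact: open_nbhs_nbhs.
    move=> /nbhs_ballP[e /= e0 eU]; apply/nbhs_ballP; exists e => // u pu.
    apply: contrapT => nTu; have : (U `&` F z) (u + z%:R).
      split; last by rewrite /F /= addrK.
      by apply: eU; move: pu; rewrite /ball /= opprD addrA addrAC.
    by rewrite UF.
  by rewrite noint.
have nonempty : [set y | (Y0 : R^o) < y] !=set0 by exists (Y0 + 1); rewrite /= ltrDl ltr01.
have [y [/= yY Fy]] := Baire FP nonempty (@open_gt _ Y0).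
by have [z Tz] := cover y (ltW yY); exact: (Fy z).
Qed.

End Interior.

(** * Complex exponentials *)

Section ComplexExponential.
Variable R : realType.

Lemma sin_le_id (x : R) : 0 <= x -> `|sin x| <= x.
Proof.
move=> x0; have [|c _] := @MVT_segment R sin cos 0 x x0.
  by apply: continuous_subspaceT => y; exact: continuous_sin.
rewrite sin0 !subr0 => ->; rewrite normrM (ger0_norm x0).
by rewrite ler_piMl // cos_max.
Qed.

Lemma cos_half (x : R) : cos (x *+ 2) = 1 - sin x ^+ 2 *+ 2.
Proof. rewrite cos_mulr2n; have := cos2Dsin2 x; lra. Qed.

Lemma cos_ge (x : R) : 0 <= x -> 1 - x ^+ 2 <= cos x.
Proof.
move=> x0; have h0 : 0 <= x / 2 by rewrite divr_ge0.
have -> : x = (x / 2) *+ 2 by rewrite -[_ *+ 2]mulr_natr divfK.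
rewrite cos_half; have : sin (x / 2) ^+ 2 <= (x / 2) ^+ 2.
  by rewrite -[X in X <= _]real_normK ?num_real // lerXn2r ?nnegrE // sin_le_id.
have := sqr_ge0 (x / 2); move: (sin (x / 2)) (x / 2) => s y; lra.
Qed.

Definition cexp (x : R) : R[i] := (cos (2 * pi * x) +i* sin (2 * pi * x))%C.

Lemma cexpD x y : cexp (x + y) = cexp x * cexp y.
Proof.
rewrite /cexp mulrDr cosD sinD; apply/eqP; rewrite eq_complex /= eqxx /=.
by rewrite addrC.
Qed.

Lemma cexp0 : cexp 0 = 1.
Proof. by rewrite /cexp mulr0 cos0 sin0. Qed.

Lemma cexpX x n : cexp x ^+ n = cexp (x * n%:R).
Proof.
elim: n => [|n ih]; first by rewrite mulr0 cexp0.
by rewrite exprS ih -cexpD -natr1 mulrDr mulr1 addrC.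
Qed.

Lemma cexp1 : cexp 1 = 1.
Proof. by rewrite /cexp mulr1 mulr_natl cos2pi sin2pi. Qed.

Lemma cexp_neq1 x : 0 < x < 1 -> cexp x != 1.
Proof.
move=> /andP[x0 x1]; rewrite eq_complex negb_and /=; apply/orP; left.
have -> : 2 * pi * x = (pi * x) *+ 2 by rewrite -mulrA mulr_natl.
rewrite cos_half; have : 0 < sin (pi * x).
  apply: sin_gt0_pi; rewrite mulr_gt0 ?pi_gt0 //=.
  by rewrite gtr_pMr ?pi_gt0.
by move: (sin _) => s s0; apply/eqP; nra.
Qed.

Lemma cexp_prim_root n : (0 < n)%N -> n.-primitive_root (cexp n%:R^-1).
Proof.
move=> n0; rewrite /primitive_root_of_unity n0; apply/forallP => i.
have nR : 0 < n%:R :> R by rewrite ltr0n.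
rewrite unity_rootE cexpX mulrC; have [->|ne] := eqVneq i.+1 n.
  by rewrite divff ?lt0r_neq0 // cexp1 eqxx.
rewrite (negbTE (cexp_neq1 _)) //; rewrite divr_gt0 ?ltr0n //= ltr_pdivrMr // mul1r.
by rewrite ltr_nat ltn_neqAle ne ltn_ord.
Qed.

Lemma cexp_exp_order b m k : (1 < b)%N ->
  (exp_order b m k).-primitive_root (cexp (m%:R / b%:R ^+ k)).
Proof.
move=> b1; rewrite mulrC -cexpX -natrX; apply: prim_root_exp_order.
by apply: cexp_prim_root; rewrite expn_gt0 ltnW.
Qed.

Lemma word_expE b j : word_exp R b j = cexp ((word_val b j)%:R / b%:R ^+ size j).
Proof. by rewrite /word_exp /cexp !mulrA. Qed.

Lemma vanishes_low_digits b (D : {fset nat}) m k : (1 < b)%N ->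
  (digit_poly R[i] D).[word_exp R b (low_digits b m k)] = 0 <->
  'Phi_(exp_order b m k) %| digit_poly int D.
Proof.
move=> b1; rewrite word_expE size_low_digits word_val_low_digits //.
have := cexp_exp_order (m %% b ^ k) k b1; rewrite exp_order_mod => z.
by rewrite (Cyclotomic_dvdp _ z) digit_poly_map; split=> [/eqP|/eqP].
Qed.

End ComplexExponential.

(** * Lower bound for the exponential sums and existence of a zero *)

Section Core.
Variables (R : realType) (b : nat) (D : {fset nat}).
Hypothesis b_gt1 : (1 < b)%N.
Hypothesis card_D : #|` D|%fset = b.

Let b_gt0 : (0 < b)%N. Proof. exact: ltnW. Qed.
Let bR_gt0 : 0 < b%:R :> R. Proof. by rewrite ltr0n. Qed.
Let bX_gt0 n : 0 < b%:R ^+ n :> R. Proof. exact: exprn_gt0. Qed.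
Let bX_neq0 n : b%:R ^+ n != 0 :> R. Proof. exact: lt0r_neq0. Qed.
Let P := digit_poly R[i] D.

Notation normc := ComplexField.Normc.normc.

Lemma normc_le (x : R[i]) (r : R) : (normc x <= r) = (`|x| <= r%:C%C).
Proof. by rewrite -lecR. Qed.

Lemma Re_le_normc (x : R[i]) : complex.Re x <= normc x.
Proof.
rewrite -lecR; apply: le_trans (normc_ge_Re x).
by rewrite lecR ler_norm.
Qed.

Lemma normc_digit_poly_ge M (x : R) : {in D, forall d, (d <= M)%N} -> 0 <= x ->
  b%:R * (1 - (2 * pi * x * M%:R) ^+ 2) <= normc P.[cexp x].
Proof.
move=> DM x0; apply: le_trans (Re_le_normc _); rewrite /P /digit_poly horner_sum raddf_sum /=.
have -> : b%:R = \sum_(d <- D) 1 :> R.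
  by rewrite big_const_seq count_predT iter_addr_0 -card_D.
rewrite mulr_suml big_seq [leRHS]big_seq; apply: ler_sum => d dD.
rewrite hornerXn cexpX /= mul1r; have p0 : 0 <= 2 * pi * x by rewrite !mulr_ge0 // pi_ge0.
have y0 : 0 <= 2 * pi * (x * d%:R) by rewrite mulrA mulr_ge0.
have z0 : 0 <= 2 * pi * x * M%:R by rewrite mulr_ge0.
apply: le_trans (cos_ge y0); rewrite lerD2l lerN2 lerXn2r ?nnegrE //.
by rewrite mulrA ler_wpM2l // ler_nat DM.
Qed.

(** The term [2 ^- J.+1] makes the induction close: for [u = 2 ^- J <= 1],
    [(1/2 + u/2) * (1 - u/4) >= 1/2 + u/4]. *)
Lemma prod_half_ge (g : nat -> R) J :
  (forall j, 1 - 2 ^- j.+2 <= g j) -> 1 / 2 + 2 ^- J.+1 <= \prod_(j < J) g j.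
Proof.
move=> gP; elim: J => [|J ih]; first by rewrite big_ord0 expr1; lra.
rewrite big_ord_recr /=; have := gP J.
have u0 : 0 < 2 ^- J :> R by rewrite invr_gt0 exprn_gt0.
have u1 : 2 ^- J <= 1 :> R by rewrite invf_le1 ?exprn_gt0 // exprn_ege1 // ler1n.
move: ih; rewrite !exprS !invfM; move: (2 ^- J) (\prod_(j < J) g j) (g J) u0 u1.
by move=> u p q u0 u1 pu qu; nra.
Qed.

Lemma sum_cexp_digit_sums m N :
  \sum_(w <- digit_sums b D N) cexp (m%:R / b%:R ^+ N : R) ^+ w =
  \prod_(i < N) P.[cexp (m%:R / b%:R ^+ i.+1)].
Proof.
rewrite sum_expr_digit_sums (reindex_inj rev_ord_inj) /=; apply: eq_bigr => i _.
rewrite cexpX natrX; congr (_.[cexp _]).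
have -> : b%:R ^+ N = b%:R ^+ i.+1 * b%:R ^+ (N - i.+1) :> R by rewrite -exprD subnKC.
by field; rewrite !bX_neq0.
Qed.

(** The factors approach [P(1) = b] so fast that the product of the [g k / b] from index [k0] on is
    at least 1/2; the finitely many earlier factors are nonzero. *)
Lemma normc_sum_digit_sums_ge m :
  (forall k, P.[cexp (m%:R / b%:R ^+ k.+1)] != 0) ->
  exists2 c : R, 0 < c & exists k, forall N, (k <= N)%N ->
    c * b%:R ^+ N <= normc (\sum_(w <- digit_sums b D N) cexp (m%:R / b%:R ^+ N : R) ^+ w).
Proof.
move=> nz; have [M DM] := digits_bounded D.
pose g k := normc P.[cexp (m%:R / b%:R ^+ k.+1)].
have g0 k : 0 < g k.
  rewrite lt_def; apply/andP; split; last first.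
    by rewrite -lecR; exact: (normr_ge0 P.[_]).
  by apply: contra_neq (nz k); exact: ComplexField.Normc.eq0_normc.
pose C := (2 * pi * m%:R * M%:R) ^+ 2 : R.
(* Chosen so that the error [C / b ^ (2 * (k0 + j + 1))] of factor [k0 + j] is at most
   [2 ^- j.+2]. *)
pose k0 := Num.bound C.
have Ck0 : C < 2 ^+ k0 by exact: upper_nthrootP.
have gk j : 1 - 2 ^- j.+2 <= g (k0 + j)%N / b%:R.
  rewrite ler_pdivlMr // mulrC; apply: le_trans (normc_digit_poly_ge DM _); last first.
    by rewrite divr_ge0 // ltW.
  rewrite ler_pM2l // lerD2l lerN2 -(mulrA 2).
  have -> : (2 * (pi * (m%:R / b%:R ^+ (k0 + j).+1)) * M%:R) ^+ 2 = C / (b%:R ^+ (k0 + j).+1) ^+ 2.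
    by rewrite /C; field.
  rewrite ler_pdivrMr ?exprn_gt0 // -ler_pdivrMl ?invr_gt0 ?exprn_gt0 // invrK.
  rewrite -exprM (le_trans (_ : _ <= 2 ^+ ((k0 + j).+1 * 2))) //; last first.
    by apply: lerXn2r; rewrite ?nnegrE // ler_nat.
  apply: (@le_trans _ _ (2 ^+ j.+2 * 2 ^+ k0)).
    by rewrite ler_pM2l ?exprn_gt0 // ltW.
  rewrite -exprD; apply: ler_weXn2l; first by rewrite ler1n.
  by lia.
exists (\prod_(i < k0) g i / b%:R ^+ k0 / 2).
  by rewrite !divr_gt0 // prodr_gt0.
exists k0 => N k0N; rewrite sum_cexp_digit_sums.
rewrite (big_morph _ (@ComplexField.Normc.normcM R) (@ComplexField.Normc.normc1 R)) -/g.
rewrite -(subnKC k0N); set J := (N - k0)%N; rewrite big_split_ord /= exprD.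
have : 1 / 2 <= \prod_(j < J) (g (k0 + j)%N / b%:R).
  by apply: le_trans (prod_half_ge J gk); rewrite lerDl invr_ge0 exprn_ge0.
rewrite prodf_div prodr_const card_ord ler_pdivlMr // => H.
have -> : \prod_(i < k0) g i / b%:R ^+ k0 / 2 * (b%:R ^+ k0 * b%:R ^+ J) =
    \prod_(i < k0) g i * (1 / 2 * b%:R ^+ J) by field.
by rewrite ler_pM2l // prodr_gt0.
Qed.

(** Without a zero, the exponential sum at [m / b ^ N] has modulus at least [c * b ^ N]. It is at
    most [b ^ N * (E N - E n)], where the mean square [E] of the counts is bounded; taking [E n]
    within [c] of the supremum is contradictory. *)
Lemma zero_of_interior m : (@self_affine_set R b D)° !=set0 -> (0 < m)%N ->
  exists2 k, (0 < k)%N & 'Phi_(exp_order b m k) %| digit_poly int D.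
Proof.
move=> Tint m0; apply: contrapT => /forall2NP nz.
have [|c c0 [k0 Hk0]] := @normc_sum_digit_sums_ge m.
  move=> k; have [//|/negP] := nz k.+1; rewrite (Cyclotomic_dvdp _ (cexp_exp_order R m k.+1 b_gt1)).
  by rewrite digit_poly_map.
have [M DM] := digits_bounded D.
pose E n : R := (energy b D n)%:R / b%:R ^+ n.
have EM n : E n <= M.+1%:R.
  rewrite /E ler_pdivrMr // -natrX -natrM ler_nat energy_le //.
  exact: uniq_digit_sums Tint.
have Esup : has_sup (range E).
  split; first by exists (E 0%N); exists 0%N.
  by exists M.+1%:R => _ [n _ <-].
have [_ [n _ <-] supE] := sup_adherent c0 Esup.
(* [s >= m] gives [0 < m / b ^ s < 1], so the frequency is not one of level [n]; [s >= k0] makes the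
   lower bound apply. *)
pose s := maxn m k0; pose N := (n + s)%N.
have ms : (m < b ^ s)%N by apply: leq_trans (ltn_expl s b_gt1); rewrite ltnS leq_maxl.
have := Hk0 N (leq_trans (leq_maxr m k0) (leq_addl n s)).
apply/negP; rewrite -ltNge.
set z := cexp _; apply: (@le_lt_trans _ _ (energy b D N - b ^ s * energy b D n)%:R).
  rewrite normc_le rmorph_nat; apply: norm_sum_digit_sums_le => //.
    rewrite cexpX natrX divfK //; rewrite -[m%:R]mul1r -cexpX cexp1; exact: expr1n.
  rewrite cexpX; have -> : m%:R / b%:R ^+ N * (b ^ n)%:R = m%:R / b%:R ^+ s :> R.
    by rewrite natrX /N exprD; field; rewrite !bX_neq0.
  apply: cexp_neq1; rewrite divr_gt0 ?ltr0n //= ltr_pdivrMr // mul1r -natrX.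
  by rewrite ltr_nat.
rewrite natrB ?energy_mono // natrM natrX -ltr_pdivrMr //.
have -> : ((energy b D N)%:R - b%:R ^+ s * (energy b D n)%:R) / b%:R ^+ N = E N - E n.
  by rewrite /E /N exprD; field; rewrite !bX_neq0.
have : E N <= sup (range E) by apply: ub_le_sup; [exact: Esup.2|exists N].
lra.
Qed.

End Core.

Theorem theorem5p6 (R : realType) (b : nat) (D : {fset nat})
    (hb : (1 < b)%N) (hD : #|` D|%fset = b) :
  [<-> tile_digit_set R b D;
       exists B : {fset seq nat},
         symmetric_blocking b B /\ vanishes_on R b D B;
       exists N : {fset {poly int}},
         phi_blocking b N /\ kernel_poly N %| digit_poly int D;
       exists k : nat, (1 <= k)%N /\ condP b D k ].
Proof.
tfae.
- move=> [_ Tint]; have [B Bsym BZ] := symmetric_blocking_of_zeros hb hD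
    (fun m => zero_of_interior hb hD Tint).
  exists B; split=> // j /BZ[m [k [bm -> zk]]]; exact/vanishes_low_digits.
- move=> [B [Bsym Bvan]]; apply: (phi_blocking_of_symmetric hb hD Bsym) => m k bm /Bvan.
  by move=> /vanishes_low_digits; apply.
- by move=> [N [Nblock Ndvd]]; exact: condP_of_phi_blocking Nblock Ndvd.
- by move=> [k [_ Pk]]; split=> //; exact: interior_of_condP Pk.
Qed.
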